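(* Let $j\ge4$ and let $A=R/I$ be a graded Artinian Gorenstein algebra of socle degree $j$ with Hilbert function $H=(1,4,7,\dots)$ and $I_2=\langle wx,wy,wz\rangle$. Let $F\in\mathcal D_j$ be a dual generator, $I=\mathrm{Ann}(F)$, and $R'=K[x,y,z]$. Then: (i) the degree-$j$ component of the inverse system of the ideal $(wx,wy,wz)$ is $\langle K_{DP}[X,Y,Z]_j,\,W^{[j]}\rangle$; (ii) $F=G+\alpha W^{[j]}$ with $G\in K_{DP}[X,Y,Z]_j$, $G\ne0$, and $\alpha\in K$, $\alpha\ne0$. The ideal $J_I=I\cap R'$ is the height three Gorenstein ideal $\mathrm{Ann}_{R'}(G)$, and there is $g\in R'_j$, $g\ne0$ (with $g\notin J_I$), such that $I=(J_I,wx,wy,wz,w^j-g)$, these being minimal generators. Moreover $H(R/I)_i=H(R'/J_I)_i+1$ for $1\le i\le j-1$, i.e. $H(R/I)=H(R'/J_I)+(0,1,1,\dots,1,0)$; the inverse system satisfies $I^\perp_j=\langle F\rangle$, $I^\perp_i=0$ for $i>j$, and $I^\perp_i=(R\circ F)_i=\langle (R'\circ G)_i,W^{[i]}\rangle$ for $1\le i\le j-1$. (iii) For a Gorenstein sequence $H=(1,4,7,\dots)$ of socle degree $j\ge 4$, the family $\mathfrak C(H)$ is nonempty if and only if $H'=H-(0,1,1,\dots,1,0)$ is a Gorenstein sequence of height three.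
   Context: $K$ is an algebraically closed field, $R=K[w,x,y,z]$ standard graded. $\mathcal D=K_{DP}[W,X,Y,Z]$ is the divided power algebra, with basis $W^{[a]}X^{[b]}Y^{[c]}Z^{[d]}$, on which $R$ acts by contraction: $x^i\circ X^{[k]}=X^{[k-i]}$ if $k\ge i$ and $0$ otherwise, extended variable by variable and linearly. For a graded Artinian Gorenstein algebra $A=R/I$ of socle degree $j$ there is $F\in\mathcal D_j$, unique up to nonzero scalar (the dual generator), with $I=\mathrm{Ann}(F)=\{h\in R: h\circ F=0\}$; the inverse system $I^\perp=\{G\in\mathcal D: h\circ G=0\ \forall h\in I\}$ equals $R\circ F$. Similarly for $R'=K[x,y,z]$ acting on $K_{DP}[X,Y,Z]$. A Gorenstein sequence of height three is the Hilbert function of a graded Artinian Gorenstein quotient of $R'$ with $h_1=3$. $\mathbb{P}\mathrm{Gor}(H)$ is the scheme parametrizing graded Artinian Gorenstein quotients $R/I$ with Hilbert function $H$, and $\mathfrak C(H)\subset\mathbb{P}\mathrm{Gor}(H)$ is the subfamily of those $R/I$ for which $I_2$ is carried to $\langle wx,wy,wz\rangle$ by a linear change of coordinates. *)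

(* Defs.v *)
From HB Require Import structures.
From mathcomp Require Import all_boot all_order all_algebra.
From mathcomp Require Import mpoly.
Set Implicit Arguments. Unset Strict Implicit. Unset Printing Implicit Defensive.
Import GRing.Theory.
Local Open Scope ring_scope.

(* Polynomial ring R = K[X_0..X_{n-1}] is {mpoly K[n]}.  The divided power
   algebra K_DP[X_0..X_{n-1}] is, as a K-vector space, represented by the
   same type {mpoly K[n]}: the monomial 'X_[u] stands for the divided-power
   monomial X^[u] = X_0^[u_0] ... X_{n-1}^[u_{n-1}].  Only the vector-space
   structure and the contraction action of R are ever used on it.          *)
Section Defs.
Variable K : fieldType.
Variable n : nat.
Local Notation P := {mpoly K[n]}.

(* p is homogeneous of degree d (0 is homogeneous of every degree) *)
Definition is_homog (d : nat) (p : P) : bool :=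
  all (fun m : 'X_{1..n} => mdeg m == d) (msupp p).

Definition contract (h F : P) : P :=
  \sum_(m <- msupp h) \sum_(u <- msupp F)
     (h@_m * F@_u) *: (if lem m u then 'X_[(u - m)%MM] else 0).

Definition Ann (F : P) (h : P) : Prop := contract h F = 0.

Definition lin_indep (s : seq P) : Prop :=
  forall c : 'I_(size s) -> K,
    \sum_(i < size s) c i *: s`_i = 0 -> forall i, c i = 0.

Definition has_dim (S : P -> Prop) (d : nat) : Prop :=
  (exists s : seq P, size s = d /\ (forall p, p \in s -> S p) /\ lin_indep s) /\
  (forall s : seq P, (forall p, p \in s -> S p) -> lin_indep s -> (size s <= d)%N).

Definition hilb_at (I : P -> Prop) (i h : nat) : Prop :=
  exists a b, has_dim (fun p => is_homog i p) a /\
              has_dim (fun p => is_homog i p /\ I p) b /\ h = (a - b)%N.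

Definition hilb_fun (I : P -> Prop) (H : nat -> nat) : Prop :=
  forall i, hilb_at I i (H i).

Definition ideal_gen_by (S : P -> Prop) (h : P) : Prop :=
  exists s : seq (P * P),
    (forall q, q \in s -> S q.2) /\ h = \sum_(q <- s) q.1 * q.2.

Definition minimal_gens (I : P -> Prop) (s : seq P) : Prop :=
  (forall p, p \in s -> exists d, is_homog d p) /\
  (forall h, I h <-> ideal_gen_by (fun p => p \in s) h) /\
  (forall i, (i < size s)%N ->
     ~ ideal_gen_by (fun p => p \in take i s ++ drop i.+1 s) s`_i).

(* F in D_j is a dual generator of a graded Artinian Gorenstein quotient
   R/Ann(F) of socle degree j (Macaulay duality) *)
Definition AG_dual (j : nat) (F : P) : Prop := is_homog j F /\ F != 0.

Definition gor_seq (H : nat -> nat) : Prop :=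
  exists j F, AG_dual j F /\ hilb_fun (Ann F) H.

Definition gor_seq_sd (H : nat -> nat) (j : nat) : Prop :=
  exists F, AG_dual j F /\ hilb_fun (Ann F) H.

End Defs.

Section Four.
Variable K : fieldType.
Local Notation R := {mpoly K[4]}.

Definition vw : R := 'X_(inord 0).
Definition vx : R := 'X_(inord 1).
Definition vy : R := 'X_(inord 2).
Definition vz : R := 'X_(inord 3).

Definition Wdp (k : nat) : R := 'X_[(U_(inord 0) *+ k)%MM].

(* inclusion K[x,y,z] -> K[w,x,y,z] (also K_DP[X,Y,Z] -> K_DP[W,X,Y,Z]) *)
Definition emb (p : {mpoly K[3]}) : R :=
  p \mPo [tuple ('X_(lift ord0 i) : R) | i < 3].

Definition coord_change (M : 'M[K]_4) (p : R) : R :=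
  p \mPo [tuple (\sum_(k < 4) M i k *: 'X_k : R) | i < 4].

Definition in_span_wxyz (q : R) : Prop :=
  exists a b c : K, q = a *: (vw * vx) + b *: (vw * vy) + c *: (vw * vz).

Definition in_C (H : nat -> nat) (F : R) : Prop :=
  (exists d, AG_dual d F) /\ hilb_fun (Ann F) H /\
  exists M : 'M[K]_4, M \in unitmx /\
    (forall p, is_homog 2 p -> Ann F p -> in_span_wxyz (coord_change M p)) /\
    (forall q, in_span_wxyz q ->
       exists p, is_homog 2 p /\ Ann F p /\ coord_change M p = q).

End Four.

Arguments vw {K}.
Arguments vx {K}.
Arguments vy {K}.
Arguments vz {K}.

(* Main.v *)
Require Import Defs.
From HB Require Import structures.
From mathcomp Require Import all_boot all_order all_algebra.
From mathcomp Require Import ssrcomplements mpoly.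
From Stdlib Require Import Classical.
Set Implicit Arguments. Unset Strict Implicit. Unset Printing Implicit Defensive.
Import GRing.Theory.
Local Open Scope ring_scope.

(* A form killed by wx, wy, wz has no mixed monomials, so F = G + a W^[j];
   neither a nor G vanishes, since otherwise w^2 or x^2 would lie in I_2.
   Contracting F by h only sees h(0,x,y,z), acting on G, and the pure powers of
   w in h, acting on a W^[j]: the degrees 1..j-1 pick up the single extra class
   w^i, and w^j is congruent to a socle generator g of R'/Ann(G).  An extra
   generator is irredundant because all others kill the divided power monomial
   dual to it.  A generator of J_I stays irredundant because J_I has no linear
   form, whence x_i g lies in R'_1 (J_I)_j: adding g creates no new relation.
   For (iii), a linear change of coordinates is transported to the inverse
   system through the pairing (p, F) |-> (p o F)_0, and conversely G + W^[j]
   realizes any H' + (0,1,...,1,0). *)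

(** * Contraction *)

(** The boundary cases all have one source: the inverse systems of [G] and of [W^[j]] meet only in
    the constants. A positive power of [W] is reached through [W^[j]] alone, but [1] is reached
    through both. So [w^i] is a new class strictly between degrees [0] and [j]; in degree [0] it is
    the class of [1], in degree [j] it can be traded for a form in [x, y, z], above [j] it is zero.
    The normalization [contract g G = alpha] makes [w^j] and [g] act on [F] alike. Contraction
    shifts exponents with no binomial factor, so the coefficient of [h o F] at [v] is the sum of
    [h_m F_(m+v)] in every characteristic. Most arguments compare such coefficients. Quotient spaces
    are never formed. A family of forms that is a basis modulo the annihilator is transported
    explicitly, and its length is the value of the Hilbert function. *)

Lemma mcoeff_contract (K : fieldType) n (h F : {mpoly K[n]}) v :
  (contract h F)@_v = \sum_(m <- msupp h) h@_m * F@_(m + v).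
Proof.
rewrite /contract raddf_sum; apply: eq_bigr => m _; rewrite raddf_sum /=.
have coefE u : ((h@_m * F@_u) *: (if lem m u then 'X_[u - m] else 0))@_v =
    if u == (m + v)%MM then h@_m * F@_u else 0.
  rewrite mcoeffZ; case: ifP => [le_mu | nle_mu].
    rewrite mcoeffX; have -> : ((u - m)%MM == v) = (u == (m + v)%MM).
      apply/eqP/eqP => [<-|->]; first by rewrite addmC submK.
      by rewrite addmC addmK.
    by case: eqP => _; rewrite ?mulr1 ?mulr0.
  rewrite mcoeff0 mulr0; case: eqP => // uE.
  by rewrite uE lem_addr in nle_mu.
rewrite (eq_bigr _ (fun u _ => coefE u)) -big_mkcond /=.
have [inF | /memN_msupp_eq0 F0] := boolP ((m + v)%MM \in msupp F).
  by rewrite -big_filter filter_pred1_uniq ?big_seq1 // msupp_uniq.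
rewrite F0 mulr0 big1_seq // => u /andP[/eqP-> _].
by rewrite F0 mulr0.
Qed.

(** Terms may cancel in a sum of operators, so additivity in [h] needs an index set independent of
    supports: all monomials below a degree bound that serves every operator involved. *)
Lemma mcoeff_contractw (K : fieldType) n k (h F : {mpoly K[n]}) v :
  (msize h <= k)%N ->
  (contract h F)@_v = \sum_(m : 'X_{1..n < k}) h@_m * F@_(m + v).
Proof.
move=> le_hk; rewrite mcoeff_contract.
rewrite (big_mksub 'X_{1..n < k}) ?msupp_uniq //=; last first.
  by move=> m /msize_mdeg_lt /leq_trans; apply.
by rewrite big_rmcond //= => m /memN_msupp_eq0 ->; rewrite mul0r.
Qed.

(** The arguments are swapped so that linearity in the operator can be registered as an instance,
    next to linearity in [F]. *)
Definition contractl (K : fieldType) n (F h : {mpoly K[n]}) := contract h F.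

Lemma contract_linearl (K : fieldType) n (F : {mpoly K[n]}) :
  linear (contractl F).
Proof.
move=> c p q; rewrite /contractl; apply/mpolyP => v; rewrite mcoeffD mcoeffZ.
set k := maxn (msize (c *: p + q)) (maxn (msize p) (msize q)).
rewrite !(@mcoeff_contractw _ _ k) ?leq_max ?leqnn ?orbT //.
rewrite mulr_sumr -big_split /=; apply: eq_bigr => m _.
by rewrite mcoeffD mcoeffZ mulrDl mulrA.
Qed.

Lemma contract_linearr (K : fieldType) n (h : {mpoly K[n]}) :
  linear (contract h).
Proof.
move=> c F G; apply/mpolyP => v; rewrite mcoeffD mcoeffZ !mcoeff_contract.
rewrite mulr_sumr -big_split /=; apply: eq_bigr => m _.
by rewrite mcoeffD mcoeffZ mulrDr mulrCA.
Qed.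

HB.instance Definition _ (K : fieldType) n (F : {mpoly K[n]}) :=
  GRing.isLinear.Build K {mpoly K[n]} {mpoly K[n]} *:%R (contractl F)
    (contract_linearl F).
HB.instance Definition _ (K : fieldType) n (h : {mpoly K[n]}) :=
  GRing.isLinear.Build K {mpoly K[n]} {mpoly K[n]} *:%R (contract h)
    (contract_linearr h).

Lemma contractDl (K : fieldType) n (F p q : {mpoly K[n]}) :
  contract (p + q) F = contract p F + contract q F.
Proof. exact: (raddfD (contractl F)). Qed.

Lemma contractBl (K : fieldType) n (F p q : {mpoly K[n]}) :
  contract (p - q) F = contract p F - contract q F.
Proof. exact: (raddfB (contractl F)). Qed.

Lemma contractZl (K : fieldType) n c (F p : {mpoly K[n]}) :
  contract (c *: p) F = c *: contract p F.
Proof. exact: (linearZZ (contractl F)). Qed.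

Lemma contract0l (K : fieldType) n (F : {mpoly K[n]}) : contract 0 F = 0.
Proof. exact: (raddf0 (contractl F)). Qed.

Lemma contract_suml (K : fieldType) n (F : {mpoly K[n]}) I (r : seq I) P f :
  contract (\sum_(i <- r | P i) f i) F = \sum_(i <- r | P i) contract (f i) F.
Proof. exact: (raddf_sum (contractl F)). Qed.

Lemma contractZr (K : fieldType) n c (h F : {mpoly K[n]}) :
  contract h (c *: F) = c *: contract h F.
Proof. exact: linearZZ. Qed.

Lemma mcoeff_contractX (K : fieldType) n m (F : {mpoly K[n]}) v :
  (contract 'X_[m] F)@_v = F@_(m + v).
Proof. by rewrite mcoeff_contract msuppX big_seq1 mcoeffX eqxx mul1r. Qed.

Lemma mnm_neq0 n (m : 'X_{1..n}) : m != 0%MM -> exists i, m i != 0%N.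
Proof.
move=> m0; apply: NNPP => no_i; case/eqP: m0; apply/mnmP => i; rewrite mnm0E.
by apply/eqP; apply: contra_notT no_i => mi; exists i.
Qed.

Lemma nonzero_coeff (K : fieldType) n (p : {mpoly K[n]}) :
  p != 0 -> exists m, p@_m != 0.
Proof.
move=> p0; apply: NNPP => no_m; case/eqP: p0; apply/mpolyP => m.
by rewrite mcoeff0; apply/eqP; apply: contra_notT no_m => pm; exists m.
Qed.

Lemma linear_mpoly_ext (K : fieldType) n (V : lmodType K)
    (f g : {linear {mpoly K[n]} -> V}) :
  (forall m, f 'X_[m] = g 'X_[m]) -> f =1 g.
Proof.
move=> fgX p; rewrite [p]mpolyE !raddf_sum; apply: eq_bigr => m _.
by rewrite /= !linearZZ fgX.
Qed.

Lemma contract1 (K : fieldType) n (F : {mpoly K[n]}) : contract 1 F = F.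
Proof.
by apply/mpolyP => v; rewrite -mpolyX0 mcoeff_contractX add0m.
Qed.

Lemma contractM (K : fieldType) n (p q F : {mpoly K[n]}) :
  contract (p * q) F = contract p (contract q F).
Proof.
rewrite [p]mpolyE mulr_suml !contract_suml; apply: eq_bigr => m _.
rewrite -scalerAl !contractZl; congr (_ *: _).
rewrite [q]mpolyE mulr_sumr !contract_suml raddf_sum /=; apply: eq_bigr => u _.
rewrite -scalerAr !contractZl contractZr; congr (_ *: _).
apply/mpolyP => v; rewrite -mpolyXD !mcoeff_contractX.
by rewrite addmA [(u + m)%MM]addmC.
Qed.

Lemma contractC (K : fieldType) n (p q F : {mpoly K[n]}) :
  contract p (contract q F) = contract q (contract p F).
Proof. by rewrite -!contractM mulrC. Qed.

Lemma is_homogP {K : fieldType} {n d} {p : {mpoly K[n]}} :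
  reflect (forall m, p@_m != 0 -> mdeg m = d) (is_homog d p).
Proof.
apply: (iffP allP) => [h m | h m].
  by rewrite -mcoeff_msupp => /h /eqP.
by rewrite mcoeff_msupp => /h /eqP.
Qed.

Lemma is_homog_dhomog {K : fieldType} {n d} (p : {mpoly K[n]}) :
  is_homog d p = (p \is d.-homog).
Proof. by rewrite dhomogE. Qed.

Lemma is_homog_coeff0 {K : fieldType} {n d} {p : {mpoly K[n]}} m :
  is_homog d p -> mdeg m != d -> p@_m = 0.
Proof. by move=> /is_homogP ph /eqP md; apply/eqP/negP => /negP /ph. Qed.

Lemma mcoeff_pihomog (K : fieldType) n d (p : {mpoly K[n]}) m :
  (pihomog mdeg d p)@_m = if mdeg m == d then p@_m else 0.
Proof.
rewrite pihomogE raddf_sum [in RHS](mpolyE p) raddf_sum /=.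
case: ifP => [/eqP md | nmd].
  rewrite [RHS](bigID (fun i => mdeg i == d)) /= [X in _ + X]big1 ?addr0 // => i.
  by apply: contraNeq; rewrite mcoeffZ mcoeffX; case: (i =P m) => [->|_]; rewrite ?md ?mulr0 ?eqxx.
rewrite big1 // => i /eqP mi; rewrite mcoeffZ mcoeffX; case: eqP => [im|_].
  by rewrite -im mi eqxx in nmd.
by rewrite mulr0.
Qed.

Lemma pihomog_deg0 (K : fieldType) n (q : {mpoly K[n]}) :
  pihomog mdeg 0 q = (q@_0)%:MP.
Proof.
apply/mpolyP => m; rewrite mcoeff_pihomog mcoeffC mdeg_eq0.
by case: eqP => [->|_]; rewrite ?mulr1 ?mulr0.
Qed.

Lemma contractCl (K : fieldType) n c (F : {mpoly K[n]}) :
  contract c%:MP F = c *: F.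
Proof. by rewrite -[c%:MP]mulr1 mul_mpolyC contractZl contract1. Qed.

Lemma homog_pihomog (K : fieldType) n d (p : {mpoly K[n]}) :
  is_homog d (pihomog mdeg d p).
Proof. by rewrite is_homog_dhomog pihomogP. Qed.

Lemma pihomog_id_homog (K : fieldType) n d (p : {mpoly K[n]}) :
  is_homog d p -> pihomog mdeg d p = p.
Proof. by rewrite is_homog_dhomog => pd; rewrite pihomog_dE. Qed.

Lemma contract_homog (K : fieldType) n d e (h F : {mpoly K[n]}) :
  is_homog d h -> is_homog (d + e) F -> is_homog e (contract h F).
Proof.
move=> hd Fde; apply/is_homogP => v; apply: contraNeq => nve.
rewrite mcoeff_contract big1_seq // => m _.
have [->|/(is_homogP hd) md] := eqVneq h@_m 0; first by rewrite mul0r.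
by rewrite (is_homog_coeff0 Fde) ?mulr0 // mdegD md eqn_add2l.
Qed.

Lemma contract_homog_gt (K : fieldType) n d e (h F : {mpoly K[n]}) :
  (e < d)%N -> is_homog d h -> is_homog e F -> contract h F = 0.
Proof.
move=> lt_ed hd Fe; apply/mpolyP => v; rewrite mcoeff0 mcoeff_contract.
rewrite big1_seq // => m _.
have [->|/(is_homogP hd) md] := eqVneq h@_m 0; first by rewrite mul0r.
rewrite (is_homog_coeff0 Fe) ?mulr0 // mdegD md neq_ltn.
by rewrite (leq_trans lt_ed) ?leq_addr ?orbT.
Qed.

(** Since [F] lives in the single degree [d + e], only the degree [d] part of [h] can land in degree
    [e]. This lets an arbitrary operator be replaced by a homogeneous one. *)
Lemma pihomog_contract (K : fieldType) n d e (h F : {mpoly K[n]}) :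
  is_homog (d + e) F ->
  pihomog mdeg e (contract h F) = contract (pihomog mdeg d h) F.
Proof.
move=> Fde; apply/mpolyP => v; rewrite mcoeff_pihomog.
pose k := maxn (msize h) (msize (pihomog mdeg d h)).
rewrite !(@mcoeff_contractw _ _ k) ?leq_maxl ?leq_maxr //.
case: ifP => [/eqP ve | nve]; [apply: eq_bigr | symmetry; apply: big1] => m _;
  rewrite mcoeff_pihomog; case: ifP => [/eqP md | nmd] //.
- rewrite mul0r (is_homog_coeff0 Fde) ?mulr0 //.
  by rewrite mdegD ve eqn_add2r nmd.
- by rewrite (is_homog_coeff0 Fde) ?mulr0 // mdegD md eqn_add2l nve.
- by rewrite mul0r.
Qed.

Lemma mcoeff_prod_contract (K : fieldType) n (h F : {mpoly K[n]}) v :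
  (contract ('X_[v] * h) F)@_0 = (contract h F)@_v.
Proof. by rewrite contractM mcoeff_contractX addm0. Qed.

(** The coefficient of [h o F] at [v] is the pairing of ['X_[v] * h] with [F]. Annihilation becomes
    a condition on scalars, the form in which it survives a change of coordinates. *)
Lemma Ann_pairing (K : fieldType) n (F h : {mpoly K[n]}) :
  Ann F h <-> forall q, (contract (q * h) F)@_0 = 0.
Proof.
split=> [hF q | hF]; first by rewrite contractM hF raddf0 mcoeff0.
by apply/mpolyP => v; rewrite -mcoeff_prod_contract hF mcoeff0.
Qed.

Lemma Ann_mull (K : fieldType) n (F q h : {mpoly K[n]}) :
  Ann F h -> Ann F (q * h).
Proof. by rewrite /Ann contractM => ->; exact: raddf0. Qed.

Lemma Ann_homog_gt {K : fieldType} {n j d} {F h : {mpoly K[n]}} :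
  is_homog j F -> (j < d)%N -> is_homog d h -> Ann F h.
Proof. by move=> Fj lt_jd hd; apply: contract_homog_gt lt_jd hd Fj. Qed.

Lemma Ann_pihomog (K : fieldType) n j d (F h : {mpoly K[n]}) :
  is_homog j F -> Ann F h -> Ann F (pihomog mdeg d h).
Proof.
move=> Fj hF; case: (leqP d j) => [le_dj | lt_jd]; last first.
  apply: (Ann_homog_gt Fj lt_jd).
  exact: homog_pihomog.
rewrite /Ann -(@pihomog_contract _ _ d (j - d)) ?subnKC //.
by rewrite hF raddf0.
Qed.

(* Linear algebra on the catalecticant matrix [F@_(u + v)]: [G] vanishes on its
   left kernel, hence is a combination of its columns. *)
Lemma perp_Ann (K : fieldType) n (F G : {mpoly K[n]}) :
  (forall h, Ann F h -> contract h G = 0) <-> exists q, G = contract q F.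
Proof.
split=> [FG | [q ->] h hF]; last by rewrite contractC hF raddf0.
pose k := maxn (msize F) (msize G).
pose T := 'X_{1..n < k}; pose N := #|{: T}|.
pose mon (i : 'I_N) : 'X_{1..n} := enum_val i.
pose C : 'M[K]_N := \matrix_(i, l) F@_(mon i + mon l).
pose g : 'rV[K]_N := \row_i G@_(mon i).
have coef0 (p : {mpoly K[n]}) m : (msize p <= k)%N -> (k <= mdeg m)%N -> p@_m = 0.
  by move=> pk km; apply/memN_msupp_eq0/msize_mdeg_ge/(leq_trans pk).
have ltk (i : 'I_N) : (mdeg (mon i) < k)%N by exact: bmdeg.
have ex_mon m : (mdeg m < k)%N -> exists i, mon i = m.
  by move=> mk; exists (enum_rank (BMultinom mk)); rewrite /mon enum_rankK.
have sum_mon (c : 'I_N -> K) (H : {mpoly K[n]}) v :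
    (contract (\sum_i c i *: 'X_[mon i]) H)@_v = \sum_i c i * H@_(mon i + v).
  rewrite contract_suml raddf_sum; apply: eq_bigr => i _.
  by rewrite contractZl /= mcoeffZ mcoeff_contractX.
have: (g <= C)%MS.
  rewrite submxE; apply/eqP/matrixP => i l; rewrite ord1 {i} [RHS]mxE.
  pose c i := cokermx C i l.
  have hF : Ann F (\sum_i c i *: 'X_[mon i]).
    apply/mpolyP => v; rewrite sum_mon mcoeff0.
    case: (ltnP (mdeg v) k) => [/ex_mon[a <-] | kv].
      have /matrixP/(_ a l) := mulmx_coker C; rewrite !mxE => Cal; rewrite -[RHS]Cal.
      by apply: eq_bigr => i _; rewrite mxE mulrC addmC.
    rewrite big1 // => i _; rewrite coef0 ?mulr0 ?leq_maxl // mdegD.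
    exact: leq_trans kv (leq_addl _ _).
  have /(congr1 (mcoeff 0)) := FG _ hF; rewrite sum_mon mcoeff0 => <-.
  by rewrite mxE; apply: eq_bigr => i _; rewrite mxE addm0 mulrC.
case/submxP => x gE; exists (\sum_i x 0 i *: 'X_[mon i]).
apply/mpolyP => v; rewrite sum_mon.
case: (ltnP (mdeg v) k) => [/ex_mon[a <-] | kv].
  have /matrixP/(_ 0 a) := gE; rewrite !mxE => ->.
  by apply: eq_bigr => i _; rewrite mxE.
rewrite coef0 ?leq_maxr // big1 // => i _; rewrite coef0 ?mulr0 ?leq_maxl // mdegD.
exact: leq_trans kv (leq_addl _ _).
Qed.

(** * Bases modulo a subspace and Hilbert functions *)

Definition subspace (K : fieldType) (V : lmodType K) (I : V -> Prop) :=
  I 0 /\ forall a p q, I p -> I q -> I (a *: p + q).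

(** Coefficients are indexed by all of [nat], so that [cons] and [cat] merely shift indices, without
    casts between ordinal types. Values beyond the length of [s] are ignored. *)
Definition lincomb (K : fieldType) (V : lmodType K) (c : nat -> K) (s : seq V) :=
  \sum_(i < size s) c i *: s`_i.

Definition indep_mod (K : fieldType) (V : lmodType K) (I : V -> Prop) s :=
  forall c : nat -> K, I (lincomb c s) -> forall i, (i < size s)%N -> c i = 0.

Definition span_mod (K : fieldType) (V : lmodType K) (I : V -> Prop) s p :=
  exists c : nat -> K, I (p - lincomb c s).

(** Taken as the modulus, the zero subspace gives back ordinary independence and span; the same
    lemmas then treat [R_d], [I_d] and [R_d/I_d]. *)
Definition null (K : fieldType) (V : lmodType K) (p : V) := p = 0.

Lemma subspace_null (K : fieldType) (V : lmodType K) : subspace (@null K V).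
Proof. by split=> // a p q; rewrite /null => -> ->; rewrite scaler0 addr0. Qed.

Lemma subspaceD (K : fieldType) (V : lmodType K) (I : V -> Prop) p q :
  subspace I -> I p -> I q -> I (p + q).
Proof. by move=> [_ I_lin] Ip Iq; rewrite -[p]scale1r; apply: I_lin. Qed.

Lemma subspaceZ (K : fieldType) (V : lmodType K) (I : V -> Prop) a p :
  subspace I -> I p -> I (a *: p).
Proof. by move=> [I0 I_lin] Ip; rewrite -[_ *: _]addr0; apply: I_lin. Qed.

Lemma subspaceN (K : fieldType) (V : lmodType K) (I : V -> Prop) p :
  subspace I -> I p -> I (- p).
Proof. by move=> sI Ip; rewrite -scaleN1r; apply: subspaceZ. Qed.

Lemma subspaceB (K : fieldType) (V : lmodType K) (I : V -> Prop) p q :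
  subspace I -> I p -> I q -> I (p - q).
Proof. by move=> sI Ip Iq; apply: subspaceD => //; apply: subspaceN. Qed.

Lemma subspace_sum (K : fieldType) (V : lmodType K) (I : V -> Prop)
    (T : finType) (f : T -> V) :
  subspace I -> (forall i, I (f i)) -> I (\sum_i f i).
Proof.
by move=> sI If; apply: big_ind => //; [case: sI | move=> p q; apply: subspaceD].
Qed.

Lemma lincomb_cat (K : fieldType) (V : lmodType K) c (s t : seq V) :
  lincomb c (s ++ t) = lincomb c s + lincomb (fun i => c (size s + i)%N) t.
Proof.
rewrite /lincomb size_cat big_split_ord /=; congr (_ + _); apply: eq_bigr => i _.
  by rewrite nth_cat ltn_ord.
by rewrite nth_cat ltnNge leq_addr /= addKn.
Qed.

Lemma lincomb_cons (K : fieldType) (V : lmodType K) c p (s : seq V) :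
  lincomb c (p :: s) = c 0%N *: p + lincomb (fun i => c i.+1) s.
Proof. by rewrite /lincomb /= big_ord_recl. Qed.

Lemma lincomb_map (K : fieldType) (U V : lmodType K) (f : {linear U -> V}) c s :
  lincomb c (map f s) = f (lincomb c s).
Proof.
rewrite /lincomb size_map raddf_sum /=; apply: eq_bigr => i _.
by rewrite linearZZ (nth_map 0).
Qed.

Lemma lin_indepE (K : fieldType) n (s : seq {mpoly K[n]}) :
  lin_indep s <-> indep_mod (@null _ _) s.
Proof.
split=> indep c c0 => [i lt_i | i].
  exact: (indep (fun i => c i) c0 (Ordinal lt_i)).
pose c' k := if insub k is Some i then c i else 0.
have c'E (l : 'I_(size s)) : c' l = c l by rewrite /c' valK.
rewrite -c'E; apply: (indep c') => //.
by rewrite /null -[RHS]c0; apply: eq_bigr => l _; rewrite c'E.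
Qed.

(** If [t] were longer than [s], the matrix expressing [t] through [s] modulo [I] would have a
    nonzero left kernel vector. That vector combines [t] into an element of [I], because the
    contributions of [s] cancel. *)
Lemma steinitz (K : fieldType) (V : lmodType K) (I : V -> Prop) (s t : seq V) :
  subspace I -> indep_mod I t -> (forall p, p \in t -> span_mod I s p) ->
  (size t <= size s)%N.
Proof.
move=> sI indep span_t; rewrite leqNgt; apply/negP => lt_st.
have /fin_all_exists[a aE] (i : 'I_(size t)) : span_mod I s t`_i.
  by apply/span_t/mem_nth.
pose A : 'M[K]_(size t, size s) := \matrix_(i, l) a i l.
have : kermx A != 0.
  rewrite -mxrank_eq0 mxrank_ker subn_eq0 -ltnNge.
  exact: leq_ltn_trans (rank_leq_col _) lt_st.
case/rowV0Pn => u /sub_kermxP uA /negP[].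
pose c k := if insub k is Some i then u 0 i else 0.
have cE (i : 'I_(size t)) : c i = u 0 i by rewrite /c valK.
have Ic : I (lincomb c t).
  have -> : lincomb c t = \sum_i u 0 i *: (t`_i - lincomb (a i) s).
    rewrite (eq_bigr _ (fun i _ => scalerBr _ _ _)) sumrB.
    rewrite [X in _ - X](_ : _ = 0) ?subr0; last first.
      rewrite (eq_bigr _ (fun i _ => scaler_sumr _ _ _ _)) exchange_big big1 //=.
      move=> l _; under eq_bigr do rewrite scalerA.
      rewrite -scaler_suml; have /matrixP/(_ 0 l) := uA; rewrite !mxE => uAl.
      rewrite (eq_bigr (fun i => u 0 i * A i l)) ?uAl ?scale0r // => i _.
      by rewrite mxE.
    by apply: eq_bigr => i _; rewrite cE.
  by apply: subspace_sum => // i; apply: subspaceZ.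
apply/eqP/rowP => i; rewrite -cE mxE; exact: indep Ic _ (ltn_ord i).
Qed.

Lemma indep_mod_cons (K : fieldType) (V : lmodType K) (I : V -> Prop) p s :
  subspace I -> indep_mod I s -> ~ span_mod I s p -> indep_mod I (p :: s).
Proof.
move=> sI indep nspan c; rewrite lincomb_cons => Ic.
have c0 : c 0%N = 0.
  apply/eqP/negP => /negP c0; case: nspan.
  exists (fun i => - ((c 0%N)^-1 * c i.+1)).
  rewrite (_ : _ - _ = (c 0%N)^-1 *: (c 0%N *: p + lincomb (fun i => c i.+1) s)).
    exact: subspaceZ.
  rewrite scalerDr scalerA mulVf // scale1r; congr (_ + _).
  rewrite -sumrN scaler_sumr; apply: eq_bigr => i _.
  by rewrite scaleNr opprK scalerA.
rewrite c0 scale0r add0r in Ic.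
by case=> [|i] // lt_i; apply: (indep _ Ic).
Qed.

(** If no independent family in [S] spanned, each could be prolonged by an element outside its span,
    and one of length [N + 1] would appear. *)
Lemma exists_basis_mod (K : fieldType) (V : lmodType K) (I S : V -> Prop) N :
  subspace I ->
  (forall s, (forall p, p \in s -> S p) -> indep_mod I s -> (size s <= N)%N) ->
  exists s, [/\ forall p, p \in s -> S p, indep_mod I s &
                forall p, S p -> span_mod I s p].
Proof.
move=> sI bound; apply: NNPP => no_basis.
have grow k : exists s, [/\ size s = k, forall p, p \in s -> S p & indep_mod I s].
  elim: k => [|k [s [sz Ss indep]]]; first by exists [::].
  apply: NNPP => no_ext; apply: no_basis; exists s; split=> // p Sp.
  apply: NNPP => nspan; apply: no_ext; exists (p :: s); split=> [|q|].
  - by rewrite /= sz.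
  - by rewrite inE => /orP[/eqP->|/Ss].
  - exact: indep_mod_cons.
have [s [sz Ss indep]] := grow N.+1.
by have := bound s Ss indep; rewrite sz ltnn.
Qed.

(** The binomial counts the monomials of degree [d] in [n + 1] variables. It bounds every
    independent family of forms, and it is the source of the [6] in [no_quadric]. *)
Lemma homog_spanning (K : fieldType) n d :
  exists t : seq {mpoly K[n.+1]},
    size t = 'C(d + n, d) /\
    forall p, is_homog d p -> span_mod (@null _ _) t p.
Proof.
pose b := vbasis {: dhomog n.+1 K d}.
exists (map (@mpoly_of_dhomog n.+1 K d) b); split=> [|p].
  by rewrite size_map size_tuple dimvf.
rewrite is_homog_dhomog => pd; pose q := DHomog pd.
have qE : q = \sum_i coord b i q *: b`_i by apply: coord_vbasis; rewrite memvf.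
exists (fun k => if insub k is Some i then coord b i q else 0).
rewrite /null; apply/eqP; rewrite subr_eq0; apply/eqP.
have -> : p = (q : {mpoly K[n.+1]}) by [].
rewrite {1}qE raddf_sum /lincomb size_map size_tuple /=; apply: eq_bigr => i _.
by rewrite (nth_map 0) ?size_tuple ?ltn_ord // valK.
Qed.

Lemma subspace_homog (K : fieldType) n d :
  subspace (fun p : {mpoly K[n]} => is_homog d p).
Proof.
split=> [|a p q]; rewrite !is_homog_dhomog ?rpred0 // => pd qd.
by rewrite rpredD ?rpredZ.
Qed.

Lemma homog_indep_bound (K : fieldType) n d (I : {mpoly K[n.+1]} -> Prop) s :
  subspace I -> (forall p, p \in s -> is_homog d p) -> indep_mod I s ->
  (size s <= 'C(d + n, d))%N.
Proof.
move=> sI sd indep; have [t [<- span_t]] := homog_spanning K n d.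
apply: (steinitz sI indep) => p /sd /span_t[c c0]; exists c.
by rewrite c0; case: sI.
Qed.

Lemma has_dim_basis (K : fieldType) n (S : {mpoly K[n]} -> Prop) s :
  (forall p, p \in s -> S p) -> indep_mod (@null _ _) s ->
  (forall p, S p -> span_mod (@null _ _) s p) -> has_dim S (size s).
Proof.
move=> Ss indep span_s; split=> [|t St /lin_indepE t_indep].
  by exists s; split=> //; split=> //; apply/lin_indepE.
by apply: (steinitz (@subspace_null _ _) t_indep) => p /St /span_s.
Qed.

Lemma has_dim_inj (K : fieldType) n (S : {mpoly K[n]} -> Prop) a b :
  has_dim S a -> has_dim S b -> a = b.
Proof.
move=> [[s [<- [Ss s_indep]]] maxa] [[t [<- [St t_indep]]] maxb].
by apply/eqP; rewrite eqn_leq maxa ?maxb.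
Qed.

Lemma has_dim_ext (K : fieldType) n (S T : {mpoly K[n]} -> Prop) a :
  (forall p, S p <-> T p) -> has_dim S a -> has_dim T a.
Proof.
move=> ST [[s [sz [Ss indep]]] maxS]; split=> [|t Tt].
  by exists s; split=> //; split=> // p /Ss /ST.
by apply: maxS => p /Tt /ST.
Qed.

Lemma hilb_at_inj (K : fieldType) n (I : {mpoly K[n]} -> Prop) i a b :
  hilb_at I i a -> hilb_at I i b -> a = b.
Proof.
move=> [p [q [Rp [Iq ->]]]] [p' [q' [Rp' [Iq' ->]]]].
by rewrite (has_dim_inj Rp Rp') (has_dim_inj Iq Iq').
Qed.

Lemma hilb_at_ext (K : fieldType) n (I J : {mpoly K[n]} -> Prop) i a :
  (forall p, I p <-> J p) -> hilb_at I i a -> hilb_at J i a.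
Proof.
move=> IJ [p [q [Rp [Iq ->]]]]; exists p, q; split=> //; split=> //.
by apply: has_dim_ext Iq => h; rewrite IJ.
Qed.

Definition homog_basis_mod (K : fieldType) n (I : {mpoly K[n]} -> Prop) d s :=
  [/\ forall p, p \in s -> is_homog d p, indep_mod I s &
      forall p, is_homog d p -> span_mod I s p].

Lemma exists_homog_basis_mod (K : fieldType) n (I : {mpoly K[n.+1]} -> Prop) d :
  subspace I -> exists s, homog_basis_mod I d s.
Proof.
move=> sI; apply: (exists_basis_mod (N := 'C(d + n, d))) => // s.
exact: homog_indep_bound.
Qed.

Lemma is_homog_lincomb (K : fieldType) n d c (s : seq {mpoly K[n]}) :
  (forall p, p \in s -> is_homog d p) -> is_homog d (lincomb c s).
Proof.
move=> sd; apply: (subspace_sum (@subspace_homog K n d)) => i.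
by apply: (subspaceZ _ (@subspace_homog K n d)); apply: sd; rewrite mem_nth.
Qed.

(** A basis [t] of the degree [d] part of [I] completes [s] to a basis of all forms of degree [d],
    so the difference of the two dimensions is the length of [s]. *)
Lemma hilb_at_basis (K : fieldType) n (I : {mpoly K[n.+1]} -> Prop) d s :
  subspace I -> homog_basis_mod I d s -> hilb_at I d (size s).
Proof.
move=> sI [sd indep span_s]; have s0 := @subspace_null K {mpoly K[n.+1]}.
have [||t [t_in t_indep span_t]] := @exists_basis_mod _ _ (@null _ _)
    (fun p : {mpoly K[n.+1]} => is_homog d p /\ I p) 'C(d + n, d) => //.
  by move=> t t_in; apply: homog_indep_bound => // p /t_in[].
exists (size (s ++ t)), (size t); split; last split.
- apply: has_dim_basis => [p|c|p pd].
  + by rewrite mem_cat => /orP[/sd|/t_in[]].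
  (* In a relation on [s ++ t] the part on [s] is minus an element of [I], so its coefficients
     vanish first; a relation on [t] alone remains. *)
  + rewrite lincomb_cat /null => /eqP; rewrite addr_eq0 => /eqP c0.
    have It : I (lincomb (fun i => c (size s + i)%N) t).
      by apply: subspace_sum => // i; apply: subspaceZ => //; apply: (t_in _ _).2; rewrite mem_nth.
    have cs : forall i, (i < size s)%N -> c i = 0.
      by apply: indep; rewrite c0; apply: subspaceN.
    move=> i; rewrite size_cat; case: (ltnP i (size s)) => [/cs // | le_si].
    rewrite -[i in (i < _)%N](subnKC le_si) ltn_add2l => lt_i.
    rewrite -(subnKC le_si); apply: (t_indep (fun i => c (size s + i)%N)) lt_i.
    rewrite /null; apply/eqP; rewrite -oppr_eq0 -c0 /lincomb big1 // => l _.
    by rewrite cs // scale0r.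
  + have [c Ic] := span_s p pd.
    have [] := span_t (p - lincomb c s).
      split=> //; apply: (subspaceB (@subspace_homog K n.+1 d)) => //.
      exact: is_homog_lincomb.
    move=> e Ie; exists (fun i => if (i < size s)%N then c i else e (i - size s)%N).
    rewrite lincomb_cat opprD addrA.
    have -> : lincomb (fun i => if (i < size s)%N then c i else e (i - size s)%N) s
       = lincomb c s by apply: eq_bigr => i _; rewrite ltn_ord.
    rewrite (_ : lincomb _ t = lincomb e t) //; apply: eq_bigr => i _.
    by rewrite ltnNge leq_addr addKn.
- by apply: has_dim_basis => // p /span_t.
- by rewrite size_cat addnK.
Qed.

Lemma subspace_Ann (K : fieldType) n (F : {mpoly K[n]}) : subspace (Ann F).
Proof.
split=> [|a p q]; rewrite /Ann ?contract0l // contractDl contractZl => -> ->.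
by rewrite scaler0 addr0.
Qed.

(** * Generated ideals *)

Lemma ideal_gen_by0 (K : fieldType) n (S : {mpoly K[n]} -> Prop) :
  ideal_gen_by S 0.
Proof. by exists [::]; rewrite big_nil. Qed.

Lemma ideal_gen_byD (K : fieldType) n (S : {mpoly K[n]} -> Prop) p q :
  ideal_gen_by S p -> ideal_gen_by S q -> ideal_gen_by S (p + q).
Proof.
move=> [s [Ss ->]] [t [St ->]]; exists (s ++ t); split; last by rewrite big_cat.
by move=> x; rewrite mem_cat => /orP[/Ss|/St].
Qed.

Lemma ideal_gen_byM (K : fieldType) n (S : {mpoly K[n]} -> Prop) r p :
  ideal_gen_by S p -> ideal_gen_by S (r * p).
Proof.
move=> [s [Ss ->]]; exists [seq (r * x.1, x.2) | x <- s]; split.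
  by move=> _ /mapP[x xs ->]; apply: Ss xs.
by rewrite big_map mulr_sumr; apply: eq_bigr => x _; rewrite mulrA.
Qed.

Lemma ideal_gen_byS (K : fieldType) n (S : {mpoly K[n]} -> Prop) p :
  S p -> ideal_gen_by S p.
Proof.
move=> Sp; exists [:: (1, p)]; rewrite big_seq1 mul1r; split=> // x.
by rewrite inE => /eqP->.
Qed.

(** The predicate need not be an ideal: additivity and the products with a generator suffice. It may
    therefore speak of a homogeneous component or of an image under [emb] or [res]. *)
Lemma ideal_gen_by_ind (K : fieldType) n (S I : {mpoly K[n]} -> Prop) h :
  I 0 -> (forall p q, I p -> I q -> I (p + q)) ->
  (forall r p, S p -> I (r * p)) -> ideal_gen_by S h -> I h.
Proof.
move=> I0 ID IM [s [Ss ->]].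
elim: s Ss => [|x s IHs] Ss; rewrite ?big_nil // big_cons.
apply: ID; first by apply/IM/Ss; rewrite mem_head.
by apply: IHs => y ys; apply: Ss; rewrite inE ys orbT.
Qed.

Lemma ideal_gen_by_trans (K : fieldType) n (S T : {mpoly K[n]} -> Prop) h :
  (forall p, S p -> ideal_gen_by T p) -> ideal_gen_by S h -> ideal_gen_by T h.
Proof.
move=> ST; apply: ideal_gen_by_ind => [|p q|r p Sp].
- exact: ideal_gen_by0.
- exact: ideal_gen_byD.
- exact/ideal_gen_byM/ST.
Qed.

Lemma ideal_gen_byZ (K : fieldType) n (S : {mpoly K[n]} -> Prop) c p :
  ideal_gen_by S p -> ideal_gen_by S (c *: p).
Proof. by rewrite -mul_mpolyC; apply: ideal_gen_byM. Qed.

Lemma ideal_gen_by_sum (K : fieldType) n (S : {mpoly K[n]} -> Prop)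
    (T : eqType) (r : seq T) f :
  (forall i, i \in r -> ideal_gen_by S (f i)) ->
  ideal_gen_by S (\sum_(i <- r) f i).
Proof.
move=> Sf; rewrite big_seq; apply: big_ind => //; last exact: ideal_gen_byD.
exact: ideal_gen_by0.
Qed.

Lemma Ann_ideal_gen_by (K : fieldType) n (F : {mpoly K[n]}) S h :
  (forall p, S p -> Ann F p) -> ideal_gen_by S h -> Ann F h.
Proof.
move=> SF; apply: ideal_gen_by_ind => [|p q|r p /SF]; last exact: Ann_mull.
  exact: contract0l.
exact: subspaceD (subspace_Ann F).
Qed.

(** * The variable [w] *)

Definition mnm_emb (m : 'X_{1..3}) : 'X_{1..4} :=
  [multinom if unlift ord0 i is Some k then m k else 0%N | i < 4].

Definition mnm_res (m : 'X_{1..4}) : 'X_{1..3} :=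
  [multinom m (lift ord0 i) | i < 3].

Definition wmnm (k : nat) : 'X_{1..4} := (U_(ord0) *+ k)%MM.

Definition res_vars (K : fieldType) : 4.-tuple {mpoly K[3]} :=
  [tuple if unlift ord0 i is Some k then 'X_k else 0 | i < 4].

Definition res (K : fieldType) (p : {mpoly K[4]}) : {mpoly K[3]} :=
  p \mPo res_vars K.

HB.instance Definition _ (K : fieldType) := GRing.RMorphism.copy (@emb K)
  (comp_mpoly [tuple ('X_(lift ord0 i) : {mpoly K[4]}) | i < 3]).
HB.instance Definition _ (K : fieldType) := GRing.Linear.copy (@emb K)
  (comp_mpoly [tuple ('X_(lift ord0 i) : {mpoly K[4]}) | i < 3]).
HB.instance Definition _ (K : fieldType) := GRing.RMorphism.copy (@res K)
  (comp_mpoly (res_vars K)).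
HB.instance Definition _ (K : fieldType) := GRing.Linear.copy (@res K)
  (comp_mpoly (res_vars K)).

Lemma embZ (K : fieldType) c (p : {mpoly K[3]}) : emb (c *: p) = c *: emb p.
Proof. exact: comp_mpolyZ. Qed.

Lemma resZ (K : fieldType) c (p : {mpoly K[4]}) : res (c *: p) = c *: res p.
Proof. exact: comp_mpolyZ. Qed.

Lemma mnm_emb0 m : mnm_emb m ord0 = 0%N.
Proof. by rewrite mnmE unlift_none. Qed.

Lemma mnm_emb_lift m i : mnm_emb m (lift ord0 i) = m i.
Proof. by rewrite mnmE liftK. Qed.

Lemma mnm_embK : cancel mnm_emb mnm_res.
Proof. by move=> m; apply/mnmP => i; rewrite mnmE mnm_emb_lift. Qed.

Lemma mnm_resK (m : 'X_{1..4}) : m ord0 = 0%N -> mnm_emb (mnm_res m) = m.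
Proof.
move=> m0; apply/mnmP => i; case: (unliftP ord0 i) => [k|] ->.
  by rewrite mnm_emb_lift mnmE.
by rewrite mnm_emb0.
Qed.

Lemma mnm_resD m u : mnm_res (m + u) = (mnm_res m + mnm_res u)%MM.
Proof. by apply/mnmP => i; rewrite mnmDE !mnmE. Qed.

Lemma mdeg_mnm4 (m : 'X_{1..4}) : mdeg m = (m ord0 + mdeg (mnm_res m))%N.
Proof.
by rewrite !mdegE big_ord_recl; congr (_ + _)%N; apply: eq_bigr => i _; rewrite mnmE.
Qed.

Lemma mdeg_emb m : mdeg (mnm_emb m) = mdeg m.
Proof. by rewrite mdeg_mnm4 mnm_emb0 mnm_embK. Qed.

Lemma wmnm0 k : wmnm k ord0 = k.
Proof. by rewrite mulmnE mnm1E eqxx mul1n. Qed.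

Lemma wmnm_lift k i : wmnm k (lift ord0 i) = 0%N.
Proof. by rewrite mulmnE mnm1E mul0n. Qed.

Lemma mnm_res_wmnm k : mnm_res (wmnm k) = 0%MM.
Proof. by apply/mnmP => i; rewrite mnmE wmnm_lift mnm0E. Qed.

Lemma mdeg_wmnm k : mdeg (wmnm k) = k.
Proof. by rewrite mdegMn mdeg1 mul1n. Qed.

Lemma wmnm_inj : injective wmnm.
Proof. by move=> k l /(congr1 mdeg); rewrite !mdeg_wmnm. Qed.

Lemma wmnmD k l : wmnm (k + l) = (wmnm k + wmnm l)%MM.
Proof. by apply/mnmP => i; rewrite mnmDE !mulmnE mulnDr. Qed.

Lemma wmnmP m : mnm_res m = 0%MM -> m = wmnm (m ord0).
Proof.
move=> m0; apply/mnmP => i; case: (unliftP ord0 i) => [k|] ->.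
  by rewrite wmnm_lift; have /mnmP/(_ k) := m0; rewrite mnmE mnm0E.
by rewrite wmnm0.
Qed.

Lemma ord_inord0 : inord 0 = ord0 :> 'I_4.
Proof. by apply: val_inj; rewrite /= inordK. Qed.

Lemma WdpE (K : fieldType) k : Wdp K k = 'X_[wmnm k].
Proof. by rewrite /Wdp ord_inord0. Qed.

Lemma vwXE (K : fieldType) k : (vw : {mpoly K[4]}) ^+ k = 'X_[wmnm k].
Proof. by rewrite /vw ord_inord0 mpolyXn. Qed.

Lemma vwE (K : fieldType) : (vw : {mpoly K[4]}) = 'X_[wmnm 1].
Proof. by rewrite -vwXE expr1. Qed.

Lemma embX (K : fieldType) m : emb ('X_[m] : {mpoly K[3]}) = 'X_[mnm_emb m].
Proof.
rewrite /emb comp_mpolyX.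
rewrite (eq_bigr (fun i => 'X_(lift ord0 i) ^+ m i)); last first.
  by move=> i _; rewrite tnth_mktuple.
rewrite (eq_bigr (fun i => 'X_[U_(lift ord0 i) *+ m i])); last first.
  by move=> i _; rewrite mpolyXn.
rewrite mprodXE; congr 'X_[_]; apply/mnmP => i; rewrite mnm_sumE.
case: (unliftP ord0 i) => [k|] ->; last first.
  by rewrite mnm_emb0 big1 // => k _; rewrite mulmnE mnm1E mul0n.
rewrite mnm_emb_lift (bigD1 k) //= mulmnE mnm1E eqxx mul1n big1 ?addn0 // => l nlk.
by rewrite mulmnE mnm1E (inj_eq lift_inj) (negPf nlk).
Qed.

Lemma resX (K : fieldType) m : res ('X_[m] : {mpoly K[4]}) =
  if m ord0 == 0%N then 'X_[mnm_res m] else 0.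
Proof.
rewrite /res comp_mpolyX big_ord_recl tnth_mktuple unlift_none expr0n.
case: eqP => _; rewrite ?mul0r // mul1r mpolyXE_id; apply: eq_bigr => i _.
by rewrite tnth_mktuple liftK mnmE.
Qed.

Lemma sum_mcoeff_delta (K : fieldType) n (p : {mpoly K[n]}) u :
  \sum_(m <- msupp p) p@_m * (m == u)%:R = p@_u.
Proof.
rewrite [in RHS](mpolyE p) raddf_sum; apply: eq_bigr => m _.
by rewrite /= mcoeffZ mcoeffX.
Qed.

Lemma mcoeff_emb (K : fieldType) (p : {mpoly K[3]}) m :
  (emb p)@_m = if m ord0 == 0%N then p@_(mnm_res m) else 0.
Proof.
rewrite [p in LHS]mpolyE (raddf_sum (@emb K)) (raddf_sum (mcoeff m)).
rewrite (eq_bigr (fun u => p@_u * (mnm_emb u == m)%:R)); last first.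
  by move=> u _; rewrite /= embZ embX mcoeffZ mcoeffX.
case: eqP => [m0|m0].
  rewrite -sum_mcoeff_delta; apply: eq_bigr => u _; congr (_ * _%:R).
  by rewrite -{1}(mnm_resK m0) (can_eq mnm_embK).
rewrite big1 // => u _; case: eqP => [um|_]; rewrite ?mulr0 //.
by case: m0; rewrite -um mnm_emb0.
Qed.

Lemma mcoeff_res (K : fieldType) (p : {mpoly K[4]}) m :
  (res p)@_m = p@_(mnm_emb m).
Proof.
rewrite [p in LHS]mpolyE (raddf_sum (@res K)) (raddf_sum (mcoeff m)).
rewrite -[RHS]sum_mcoeff_delta.
apply: eq_bigr => u _; rewrite /= resZ resX mcoeffZ; congr (_ * _).
case: eqP => [u0|u0]; rewrite ?mcoeffX ?mcoeff0.
  by rewrite -{2}(mnm_resK u0) (can_eq mnm_embK).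
by case: eqP => // um; case: u0; rewrite um mnm_emb0.
Qed.

Lemma embK (K : fieldType) : cancel (@emb K) (@res K).
Proof.
by move=> p; apply/mpolyP => m; rewrite mcoeff_res mcoeff_emb mnm_emb0 mnm_embK.
Qed.

Lemma emb_homog (K : fieldType) d (p : {mpoly K[3]}) :
  is_homog d p -> is_homog d (emb p).
Proof.
move=> /is_homogP pd; apply/is_homogP => m; rewrite mcoeff_emb.
by case: (m ord0 =P 0%N) => [m0 /pd <-|]; rewrite ?eqxx // mdeg_mnm4 m0.
Qed.

Lemma res_homog (K : fieldType) d (p : {mpoly K[4]}) :
  is_homog d p -> is_homog d (res p).
Proof.
move=> /is_homogP pd; apply/is_homogP => m; rewrite mcoeff_res => /pd.
by rewrite mdeg_emb.
Qed.

Lemma homogX (K : fieldType) n (m : 'X_{1..n}) :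
  is_homog (mdeg m) ('X_[m] : {mpoly K[n]}).
Proof. by rewrite is_homog_dhomog dhomogX. Qed.

Lemma Wdp_homog (K : fieldType) k : is_homog k (Wdp K k).
Proof. by rewrite WdpE; have := homogX K (wmnm k); rewrite mdeg_wmnm. Qed.

(** A monomial divisible by [w] kills every monomial free of [W]; the remaining ones act as in three
    variables. By linearity it is enough to compare on monomials. *)
Lemma contract_emb (K : fieldType) (h : {mpoly K[4]}) G :
  contract h (emb G) = emb (contract (res h) G).
Proof.
apply: (@linear_mpoly_ext K 4 _ (contractl (emb G)) (@emb K \o contractl G \o @res K)).
move=> m; apply/mpolyP => v; rewrite /= /contractl mcoeff_contractX !mcoeff_emb.
rewrite resX mnmDE addn_eq0 mnm_resD.
case: (m ord0 == 0%N); last by rewrite contract0l mcoeff0; case: ifP.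
by rewrite mcoeff_contractX.
Qed.

Lemma contract_Wdp (K : fieldType) (h : {mpoly K[4]}) j :
  contract h (Wdp K j) = \sum_(k < j.+1) h@_(wmnm k) *: Wdp K (j - k).
Proof.
apply/mpolyP => v; rewrite mcoeff_contract raddf_sum /=.
under eq_bigr => m _ do rewrite WdpE mcoeffX.
under [RHS]eq_bigr => k _ do rewrite mcoeffZ WdpE mcoeffX.
(* Both sides are supported on the powers [W^[l]] with [l <= j]; at such a power the right side has
   the single term [k = j - l]. *)
have [[l [lj vE]]|nv] := classic (exists l, (l <= j)%N /\ v = wmnm l).
  rewrite (bigD1 (inord (j - l))) //= inordK ?ltnS ?leq_subr // subKn //.
  rewrite vE eqxx mulr1 [X in _ = _ + X]big1 ?addr0; last first.
    move=> k; case: (wmnm (j - k) =P wmnm l) => [jk|_]; rewrite ?mulr0 //.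
    by case/negP; apply/eqP/val_inj; rewrite /= inordK ?ltnS ?leq_subr // -(wmnm_inj jk) subKn // -ltnS.
  rewrite -sum_mcoeff_delta; apply: eq_bigr => m _; congr (_ * _%:R).
  by rewrite -{1}(subnK lj) wmnmD eqm_add2r eq_sym.
rewrite !big1 // => [k _|m _].
  by case: eqP => [jkv|_]; rewrite ?mulr0 //; case: nv; exists (j - k)%N; rewrite leq_subr.
case: eqP => [jmv|_]; rewrite ?mulr0 //; case: nv; exists (v ord0).
have j0 : (m ord0 + v ord0)%N = j by rewrite -mnmDE -jmv wmnm0.
split; first by rewrite -j0 leq_addl.
apply: wmnmP; have /eqP := congr1 mnm_res jmv.
by rewrite mnm_res_wmnm mnm_resD eq_sym mnmD_eq0 => /andP[_ /eqP].
Qed.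

(** The substitution [x = y = z = 0]. It complements [res], the substitution [w = 0]: together they
    see every monomial outside the ideal [(wx, wy, wz)], and both see the constant. As a ring
    morphism it is easily computed on products. *)
Definition wpart (K : fieldType) (p : {mpoly K[4]}) : {poly K} :=
  mmap (@polyC K) (fun i => if i == ord0 then 'X else 0) p.

HB.instance Definition _ (K : fieldType) := GRing.RMorphism.copy (@wpart K)
  (mmap (@polyC K) (fun i : 'I_4 => if i == ord0 then 'X else 0)).

Lemma wpartX (K : fieldType) m : wpart ('X_[m] : {mpoly K[4]}) =
  if mnm_res m == 0%MM then 'X^(m ord0) else 0.
Proof.
rewrite /wpart mmapX /mmap1 big_ord_recl eqxx.
case: eqP => [m0|/eqP/mnm_neq0[i]].
  rewrite big1 ?mulr1 // => i _.
  by have /mnmP/(_ i) := m0; rewrite mnmE mnm0E => ->.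
by rewrite mnmE => mi; rewrite (bigD1 i) //= expr0n (negPf mi) mul0r mulr0.
Qed.

Lemma coef_wpart (K : fieldType) (p : {mpoly K[4]}) k :
  (wpart p)`_k = p@_(wmnm k).
Proof.
rewrite -sum_mcoeff_delta /wpart /mmap coef_sum; apply: eq_bigr => m _.
have -> : mmap1 (fun i => if i == ord0 then 'X else 0) m = wpart ('X_[m] : {mpoly K[4]}).
  by rewrite /wpart mmapX.
rewrite coefCM wpartX; congr (_ * _).
case: (mnm_res m =P 0%MM) => [/wmnmP mE|m0]; last first.
  rewrite coef0; case: (m =P wmnm k) => // mE.
  by case: m0; rewrite mE mnm_res_wmnm.
by rewrite coefXn [in RHS]mE (inj_eq wmnm_inj) eq_sym.
Qed.

Lemma wpart_vw (K : fieldType) : wpart (vw : {mpoly K[4]}) = 'X.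
Proof. by rewrite vwE wpartX mnm_res_wmnm eqxx wmnm0 expr1. Qed.

Lemma mcoeff_emb_wmnm (K : fieldType) (p : {mpoly K[3]}) k :
  (emb p)@_(wmnm k) = if k == 0%N then p@_0 else 0.
Proof. by rewrite mcoeff_emb wmnm0 mnm_res_wmnm. Qed.

Lemma wpart_emb (K : fieldType) (p : {mpoly K[3]}) :
  wpart (emb p) = (p@_0)%:P.
Proof.
by apply/polyP => k; rewrite coef_wpart mcoeff_emb_wmnm coefC.
Qed.

Lemma res_vw (K : fieldType) : res (vw : {mpoly K[4]}) = 0.
Proof. by rewrite vwE resX wmnm0. Qed.

(* [p] lies in the span of the monomials of the ideal [(wx, wy, wz)] *)
Definition mixed (K : fieldType) (p : {mpoly K[4]}) :=
  res p = 0 /\ wpart p = 0.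

Lemma mixed_coef (K : fieldType) (p : {mpoly K[4]}) m :
  mixed p -> p@_m != 0 -> m ord0 != 0%N /\ mnm_res m != 0%MM.
Proof.
move=> [p_res p_w] pm; split; apply: contraNneq pm => m0.
  by rewrite -(mnm_resK m0) -mcoeff_res p_res mcoeff0.
by rewrite (wmnmP m0) -coef_wpart p_w coef0.
Qed.

Definition wxyz (K : fieldType) (p : {mpoly K[4]}) :=
  p = vw * vx \/ p = vw * vy \/ p = vw * vz.

Lemma emb_vars (K : fieldType) :
  [/\ emb 'X_0 = vx :> {mpoly K[4]}, emb 'X_1 = vy :> {mpoly K[4]} &
      emb 'X_(inord 2) = vz :> {mpoly K[4]}].
Proof.
have embE (i : 'I_3) (k : 'I_4) : lift ord0 i = k -> emb 'X_i = 'X_k :> {mpoly K[4]}.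
  move=> <-; rewrite embX; congr 'X_[_]; apply/mnmP => l; rewrite mnm1E.
  case: (unliftP ord0 l) => [k'|] ->; last by rewrite mnm_emb0.
  by rewrite mnm_emb_lift mnm1E (inj_eq lift_inj).
by split; apply: embE; apply: val_inj; rewrite /= !inordK.
Qed.

Lemma ord3P (P : 'I_3 -> Prop) : P 0 -> P 1 -> P (inord 2) -> forall i, P i.
Proof.
move=> P0 P1 P2 [[|[|[|//]]] lt_i].
- by rewrite (_ : Ordinal _ = 0) //; apply: val_inj.
- by rewrite (_ : Ordinal _ = 1) //; apply: val_inj.
- by rewrite (_ : Ordinal _ = inord 2) //; apply: val_inj; rewrite /= inordK.
Qed.

Lemma wxyzP (K : fieldType) (p : {mpoly K[4]}) :
  wxyz p <-> exists i : 'I_3, p = vw * emb 'X_i.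
Proof.
rewrite /wxyz; have [<- <- <-] := emb_vars K.
split=> [[->|[->|->]]|[i ->]]; [by exists 0|by exists 1|by exists (inord 2)|].
by elim/ord3P: i; [left|right; left|right; right].
Qed.

Lemma mixed_wxyz (K : fieldType) i : mixed (vw * emb 'X_i : {mpoly K[4]}).
Proof.
split; rewrite rmorphM /= ?res_vw ?mul0r //.
by rewrite wpart_emb mcoeffX mnm1_eq0 mulr0.
Qed.

(** Such a monomial is divisible by some [w x_i]. The equation of exponents is recorded as well, for
    the coefficient comparison in [perp_wxyz] and the degree count in [mixed_quadric]. *)
Lemma wxyz_monomial (K : fieldType) (m : 'X_{1..4}) : m ord0 != 0%N -> mnm_res m != 0%MM ->
  exists u (i : 'I_3), 'X_[m] = 'X_[u] * (vw * emb 'X_i) :> {mpoly K[4]} /\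
    m = (u + (wmnm 1 + mnm_emb U_(i)))%MM.
Proof.
move=> m0 /mnm_neq0[i]; rewrite mnmE => mi.
suff mE : m = (m - (wmnm 1 + mnm_emb U_(i)) + (wmnm 1 + mnm_emb U_(i)))%MM.
  by exists (m - (wmnm 1 + mnm_emb U_(i)))%MM, i; split=> //;
    rewrite [in LHS]mE !mpolyXD vwE embX.
rewrite submK //; apply/mnm_lepP => k; rewrite mnmDE.
case: (unliftP ord0 k) => [k'|] ->.
  rewrite wmnm_lift mnm_emb_lift mnm1E add0n.
  by case: eqP => // <-; rewrite lt0n.
by rewrite wmnm0 mnm_emb0 addn0 lt0n.
Qed.

Lemma mixed_ideal (K : fieldType) (p : {mpoly K[4]}) :
  mixed p -> ideal_gen_by (@wxyz K) p.
Proof.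
move=> p_mixed; rewrite [p]mpolyE; apply: ideal_gen_by_sum => m.
rewrite mcoeff_msupp => /(mixed_coef p_mixed)[m0 mres0].
have [u [i [-> _]]] := wxyz_monomial K m0 mres0.
by apply/ideal_gen_byZ/ideal_gen_byM/ideal_gen_byS/wxyzP; exists i.
Qed.

Lemma in_span_wxyzP (K : fieldType) (q : {mpoly K[4]}) :
  in_span_wxyz q <-> exists c : 'I_3 -> K, q = \sum_i c i *: (vw * emb 'X_i).
Proof.
have sum3 (c : 'I_3 -> K) : \sum_i c i *: (vw * emb 'X_i : {mpoly K[4]}) =
   c 0 *: (vw * vx) + c 1 *: (vw * vy) + c (inord 2) *: (vw * vz).
  have [<- <- <-] := emb_vars K; rewrite !big_ord_recr big_ord0 /= add0r.
  by congr (_ + _ + _); congr (c _ *: (_ * emb 'X_(_))); apply: val_inj; rewrite //= inordK.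
split=> [[a [b [c ->]]]|[c ->]]; last by exists (c 0), (c 1), (c (inord 2)); rewrite sum3.
exists (fun i : 'I_3 => nth 0 [:: a; b; c] i).
by rewrite sum3 /= inordK.
Qed.

Lemma mixed_span (K : fieldType) (q : {mpoly K[4]}) : in_span_wxyz q -> mixed q.
Proof.
case/in_span_wxyzP => c ->; split; rewrite raddf_sum big1 // => i _ /=.
  by rewrite resZ (mixed_wxyz K i).1 scaler0.
by rewrite -mul_mpolyC rmorphM /= (mixed_wxyz K i).2 mulr0.
Qed.

(** * Dual generators of the form [G + a W^[j]] *)

Definition split_dual (K : fieldType) j (G : {mpoly K[3]}) a : {mpoly K[4]} :=
  emb G + a *: Wdp K j.

Lemma split_homog (K : fieldType) j (G : {mpoly K[3]}) a :
  is_homog j G -> is_homog j (split_dual j G a).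
Proof.
move=> Gj; apply: (subspaceD (@subspace_homog K 4 j)); first exact: emb_homog.
exact: (subspaceZ _ (@subspace_homog K 4 j)) (Wdp_homog K j).
Qed.

Lemma contract_split (K : fieldType) j (G : {mpoly K[3]}) a h :
  contract h (split_dual j G a) =
  emb (contract (res h) G) +
  a *: \sum_(k < j.+1) h@_(wmnm k) *: Wdp K (j - k).
Proof. by rewrite raddfD /= contractZr contract_emb contract_Wdp. Qed.

Lemma contract_split_homog (K : fieldType) j (G : {mpoly K[3]}) a d h :
  (d <= j)%N -> is_homog d h ->
  contract h (split_dual j G a) =
  emb (contract (res h) G) + (a * h@_(wmnm d)) *: Wdp K (j - d).
Proof.
move=> le_dj hd; rewrite contract_split -scalerA; congr (_ + _ *: _).
have dj : (d < j.+1)%N by [].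
rewrite (bigD1 (Ordinal dj)) //= big1 ?addr0 // => k nkd.
rewrite (is_homog_coeff0 hd) ?scale0r // mdeg_wmnm.
by apply: contraNneq nkd => kd; apply/eqP/val_inj.
Qed.

Lemma mixed_contract (K : fieldType) j (G : {mpoly K[3]}) a h :
  mixed h -> contract h (split_dual j G a) = 0.
Proof.
move=> [h_res h_w]; rewrite contract_split h_res contract0l raddf0 add0r.
by rewrite big1 ?scaler0 // => k _; rewrite -coef_wpart h_w coef0 scale0r.
Qed.

(** The coefficient of [G0] at a mixed monomial [u w x_i] is the coefficient at [u] of [w x_i o G0],
    hence zero. What is left is the part free of [W] and the pure power of degree [j]. *)
Lemma perp_wxyz (K : fieldType) j (G0 : {mpoly K[4]}) : (0 < j)%N ->
  is_homog j G0 ->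
  (forall h, ideal_gen_by (@wxyz K) h -> contract h G0 = 0) <->
  exists G' a, is_homog j G' /\ G0 = split_dual j G' a.
Proof.
move=> j0 G0j; split=> [G0_perp | [G' [a [_ ->]]] h]; last first.
  apply: Ann_ideal_gen_by => p /wxyzP[i ->]; apply: mixed_contract.
  exact: mixed_wxyz.
exists (res G0), G0@_(wmnm j); split; first exact: res_homog.
apply/mpolyP => m; rewrite mcoeffD mcoeff_emb mcoeffZ WdpE mcoeffX mcoeff_res.
have [m0 | m0] := eqVneq (m ord0) 0%N.
  rewrite mnm_resK //; case: (wmnm j =P m) => [jm|_]; last by rewrite mulr0 addr0.
  (* Here [0 < j] counts: in degree [0] the constant would appear both in [res G0] and as
     [W^[0]]. *)
  by rewrite -jm wmnm0 in m0; rewrite m0 in j0.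
rewrite add0r; have [mr|mr] := eqVneq (mnm_res m) 0%MM.
  rewrite (wmnmP mr); case: (wmnm j =P _) => [<-|jm]; first by rewrite mulr1.
  rewrite mulr0 (is_homog_coeff0 G0j) // mdeg_wmnm; apply/eqP => mj.
  by case: jm; rewrite mj.
have [u [i [_ ->]]] := wxyz_monomial K m0 mr.
have -> : (wmnm j == u + (wmnm 1 + mnm_emb U_(i)))%MM = false.
  apply/eqP => /(congr1 (fun m : 'X_{1..4} => m (lift ord0 i))).
  by rewrite !mnmDE !wmnm_lift mnm_emb_lift mnm1E eqxx !addnA addn1.
rewrite [(u + _)%MM]addmC.
have := G0_perp (vw * emb 'X_i); rewrite mulr0 => /(_ _)/(congr1 (mcoeff u)).
rewrite vwE embX -mpolyXD mcoeff_contractX mcoeff0 => -> //.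
by apply/ideal_gen_byS/wxyzP; exists i; rewrite vwE embX mpolyXD.
Qed.

Lemma Ann_coeff0 (K : fieldType) n j (G q : {mpoly K[n]}) :
  is_homog j G -> G != 0 -> Ann G q -> q@_0 = 0.
Proof.
move=> Gj G0 /(Ann_pihomog 0 Gj).
rewrite pihomog_deg0 /Ann contractCl.
by move/eqP; rewrite scaler_eq0 (negPf G0) orbF => /eqP.
Qed.

Lemma emb_inj (K : fieldType) : injective (@emb K).
Proof. exact: can_inj (@embK K). Qed.

(** The coefficient of [h o F] at [W^[j-k]] is [a] times that of [h] at [w^k], because [emb G]
    contributes no positive power of [W]. The bound [k < j] is sharp: for [k = j] the constant
    coming from [G] can cancel, as it does for [w^j - g]. *)
Lemma Ann_split_coeff (K : fieldType) j (G : {mpoly K[3]}) a h k :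
  a != 0 -> Ann (split_dual j G a) h -> (k < j)%N -> h@_(wmnm k) = 0.
Proof.
move=> a0; rewrite /Ann contract_split => hF kj.
have /(congr1 (mcoeff (wmnm (j - k)))) := hF.
rewrite mcoeffD mcoeff_emb_wmnm subn_eq0 leqNgt kj add0r mcoeffZ raddf_sum mcoeff0.
have kj' : (k < j.+1)%N by rewrite ltnW.
rewrite (bigD1 (Ordinal kj')) //= big1 ?addr0 => [|l nlk].
  rewrite mcoeffZ WdpE mcoeffX eqxx mulr1 => /eqP.
  by rewrite mulf_eq0 (negPf a0) => /eqP.
rewrite mcoeffZ WdpE mcoeffX; case: eqP => [/wmnm_inj jlk|]; rewrite ?mulr0 //.
case/negP: nlk; apply/eqP/val_inj => /=.
by rewrite -(subKn (ltnW kj)) -jlk subKn // -ltnS.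
Qed.

(** The only pure power of [w] in [emb q] is the constant term, and annihilating either dual
    generator forces it to vanish. *)
Lemma Ann_split_emb (K : fieldType) j (G : {mpoly K[3]}) a q : (0 < j)%N ->
  is_homog j G -> G != 0 -> a != 0 ->
  Ann (split_dual j G a) (emb q) <-> Ann G q.
Proof.
move=> j0 Gj G0 a0.
have sumE : \sum_(k < j.+1) (emb q)@_(wmnm k) *: Wdp K (j - k) = q@_0 *: Wdp K j.
  rewrite big_ord_recl subn0 mcoeff_emb_wmnm big1 ?addr0 // => k _.
  by rewrite mcoeff_emb_wmnm scale0r.
split=> [qF|qG]; last first.
  by rewrite /Ann contract_split embK qG raddf0 sumE (Ann_coeff0 Gj G0 qG) scale0r scaler0 addr0.
have := Ann_split_coeff a0 qF j0; rewrite mcoeff_emb_wmnm eqxx => q0.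
move: qF; rewrite /Ann contract_split embK sumE q0 scale0r scaler0 addr0 => qG.
by apply: emb_inj; rewrite qG raddf0.
Qed.

(** A monomial on which [G] has a nonzero coefficient, suitably rescaled, will do; all other
    coefficients of the result vanish for degree reasons. *)
Lemma exists_socle_gen (K : fieldType) n j (G : {mpoly K[n]}) a :
  is_homog j G -> G != 0 ->
  exists g, is_homog j g /\ contract g G = a%:MP.
Proof.
move=> Gj G0; have [m Gm] := nonzero_coeff G0.
have mj := is_homogP Gj m Gm; exists ((a / G@_m) *: 'X_[m]); split.
  apply: (subspaceZ _ (@subspace_homog K n j)); rewrite -mj; exact: homogX.
apply/mpolyP => v; rewrite contractZl mcoeffZ mcoeff_contractX mcoeffC.
case: (eqVneq v 0%MM) => [->|v0]; first by rewrite addm0 mulfVK ?mulr1.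
rewrite (is_homog_coeff0 (m := (m + v)%MM) Gj) ?mulr0 // mdegD mj.
by rewrite -{2}[j]addn0 eqn_add2l mdeg_eq0.
Qed.

Lemma vwX_homog (K : fieldType) k : is_homog k ((vw : {mpoly K[4]}) ^+ k).
Proof. by rewrite vwXE; have := homogX K (wmnm k); rewrite mdeg_wmnm. Qed.

Lemma is_homogB (K : fieldType) n d (p q : {mpoly K[n]}) :
  is_homog d p -> is_homog d q -> is_homog d (p - q).
Proof. exact: subspaceB (@subspace_homog K n d). Qed.

Lemma is_homogM (K : fieldType) n d e (p q : {mpoly K[n]}) :
  is_homog d p -> is_homog e q -> is_homog (d + e) (p * q).
Proof. by rewrite !is_homog_dhomog; apply: dhomogM. Qed.

Lemma Ann_split_socle (K : fieldType) j (G g : {mpoly K[3]}) a :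
  (0 < j)%N -> is_homog j g -> contract g G = a%:MP ->
  Ann (split_dual j G a) (vw ^+ j - emb g).
Proof.
move=> j0 gj gG; rewrite /Ann (contract_split_homog _ _ (leqnn j)); last first.
  by apply: is_homogB; [exact: vwX_homog | exact: emb_homog].
rewrite mcoeffB mcoeff_emb_wmnm (gtn_eqF j0) subr0 vwXE mcoeffX eqxx mulr1.
rewrite raddfB /= resX wmnm0 (gtn_eqF j0) sub0r embK.
rewrite -[- g]scaleN1r contractZl gG subnn WdpE mpolyX0 scaleN1r raddfN /=.
rewrite -{1}[a%:MP]mulr1 mul_mpolyC embZ rmorph1.
by rewrite addNr.
Qed.

(** By [Ann_split_coeff] the pure [w]-part of an annihilator [h] is divisible by [w^j], so some
    multiple [x] of [w^j - g] has the same pure [w]-part. Then [h - x] is a mixed polynomial plus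
    one free of [w], and the latter kills [F] because all the others do. *)
Lemma Ann_split_gens (K : fieldType) j (G g : {mpoly K[3]}) a h :
  (0 < j)%N -> is_homog j G -> G != 0 -> a != 0 ->
  is_homog j g -> contract g G = a%:MP ->
  Ann (split_dual j G a) h <->
  ideal_gen_by (fun p => (exists q, Ann (split_dual j G a) (emb q) /\ p = emb q) \/
    p = vw * vx \/ p = vw * vy \/ p = vw * vz \/ p = vw ^+ j - emb g) h.
Proof.
move=> j0 Gj G0 a0 gj gG; set F := split_dual j G a.
have F_wxyz p : wxyz p -> Ann F p.
  by case/wxyzP=> i ->; apply: mixed_contract; apply: mixed_wxyz.
have F_socle : Ann F (vw ^+ j - emb g) by apply: Ann_split_socle.
split=> [hF|]; last first.
  apply: Ann_ideal_gen_by => p [[q [qF ->]] //|[|[|[|->]]] // pE]; apply: F_wxyz.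
  - by left.
  - by right; left.
  - by right; right.
pose N := msize h.
pose Q : {poly K} := \poly_(k < N) h@_(wmnm (j + k)).
(* The multiplier is the pure [w]-part of [h] divided by [w^j]. As [g] has no constant term, [wpart]
   sends [w^j - g] to [w^j] exactly. *)
pose x : {mpoly K[4]} := (\sum_(k < N) h@_(wmnm (j + k)) *: vw ^+ k) * (vw ^+ j - emb g).
have wx : wpart x = Q * 'X^j.
  rewrite rmorphM rmorphB rmorphXn /= wpart_vw wpart_emb.
  rewrite (is_homog_coeff0 gj) ?mdeg0 1?eq_sym -?lt0n // subr0; congr (_ * _).
  rewrite raddf_sum /Q poly_def; apply: eq_bigr => k _ /=.
  rewrite -mul_mpolyC rmorphM rmorphXn /= wpart_vw -mul_polyC; congr (_ * _).
  by rewrite /wpart mmapC.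
have wh : wpart h = wpart x.
  rewrite wx; apply/polyP => k; rewrite coef_wpart coefMXn coef_poly.
  case: (ltnP k j) => [kj|jk]; first exact: Ann_split_coeff hF kj.
  rewrite subnKC //; case: ltnP => // Nk.
  apply/memN_msupp_eq0/msize_mdeg_ge; rewrite mdeg_wmnm.
  exact: leq_trans Nk (leq_subr _ _).
pose y := res (h - x).
have r_mixed : mixed (h - x - emb y).
  split; rewrite raddfB /= ?embK ?subrr // [wpart (h - x)]raddfB /= wh subrr sub0r.
  rewrite wpart_emb mcoeff_res -{1}[mnm_emb 0](_ : wmnm 0 = _).
    by rewrite -coef_wpart raddfB /= wh subrr coef0 polyC0 oppr0.
  by apply/mnmP => i; case: (unliftP ord0 i) => [k|] ->;
    rewrite ?wmnm0 ?mnm_emb0 // wmnm_lift mnm_emb_lift mnm0E.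
have yF : Ann F (emb y).
  have -> : emb y = h - x - (h - x - emb y) by rewrite opprB addrC subrK.
  apply: (subspaceB (subspace_Ann F)); last exact: mixed_contract.
  by apply: (subspaceB (subspace_Ann F)) => //; apply: Ann_mull.
have -> : h = emb y + (x + (h - x - emb y)).
  by rewrite addrC -addrA subrK addrC subrK.
apply: ideal_gen_byD; first by apply: ideal_gen_byS; left; exists y.
apply: ideal_gen_byD.
  by apply/ideal_gen_byM/ideal_gen_byS; do 4 right.
apply: ideal_gen_by_trans (mixed_ideal r_mixed) => p pE; apply: ideal_gen_byS.
by right; case: pE => [|[]]; tauto.
Qed.

(** * Bases and Hilbert function for a split dual generator *)

Lemma homog_reduce (K : fieldType) d (p : {mpoly K[4]}) : is_homog d p ->
  let q := res (p - p@_(wmnm d) *: vw ^+ d) in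
  is_homog d q /\ mixed (p - (p@_(wmnm d) *: vw ^+ d + emb q)).
Proof.
(* The term in [w^d] is removed before restricting to [w = 0]; otherwise the constant would be
   counted twice when [d = 0]. *)
move=> pd; set x := _ *: _; set q := res _ => /=.
have pxd : is_homog d (p - x).
  by apply: is_homogB => //; apply: (subspaceZ _ (@subspace_homog K 4 d)) (vwX_homog K d).
have wpx : wpart (p - x) = 0.
  apply/polyP => k; rewrite coef_wpart coef0 mcoeffB mcoeffZ vwXE mcoeffX.
  case: (wmnm d =P wmnm k) => [<-|dk]; first by rewrite mulr1 subrr.
  rewrite mulr0 subr0 (is_homog_coeff0 pd) // mdeg_wmnm.
  by apply/eqP => kd; case: dk; rewrite kd.
split; first exact: res_homog.
rewrite opprD addrA; split; rewrite raddfB /= ?embK ?subrr // wpx sub0r wpart_emb.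
have mnm00 : mnm_emb 0 = wmnm 0.
  by apply/mnmP => i; case: (unliftP ord0 i) => [k|] ->;
    rewrite ?wmnm0 ?mnm_emb0 // wmnm_lift mnm_emb_lift mnm0E.
by rewrite mcoeff_res mnm00 -coef_wpart wpx coef0 polyC0 oppr0.
Qed.

(** Independence of [w^i] uses both bounds: [i < j] makes the [w^i] coefficient of an annihilator
    vanish, and [0 < i] keeps the embedded forms from contributing to it. *)
Lemma split_basis_mid (K : fieldType) j (G : {mpoly K[3]}) a i s :
  is_homog j G -> G != 0 -> a != 0 -> (0 < i < j)%N ->
  homog_basis_mod (Ann G) i s ->
  homog_basis_mod (Ann (split_dual j G a)) i (vw ^+ i :: map (@emb K) s).
Proof.
move=> Gj G0 a0 /andP[i0 ij] [si indep span_s]; have j0 := ltn_trans i0 ij.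
split=> [p|c|p pi].
- rewrite inE => /orP[/eqP->|/mapP[q qs ->]]; first exact: vwX_homog.
  exact/emb_homog/si.
- rewrite lincomb_cons lincomb_map => cF.
  have c0 : c 0%N = 0.
    have := Ann_split_coeff a0 cF ij.
    rewrite mcoeffD mcoeffZ vwXE mcoeffX eqxx mulr1 mcoeff_emb_wmnm (gtn_eqF i0).
    by rewrite addr0.
  rewrite c0 scale0r add0r in cF; move/(Ann_split_emb _ j0 Gj G0 a0): cF => cG.
  by case=> [|k] //=; rewrite ltnS size_map => ks; apply: (indep _ cG).
- have [qi r_mixed] := homog_reduce pi; set q := res _ in qi r_mixed.
  have [c cG] := span_s q qi.
  exists (fun k => if k is l.+1 then c l else p@_(wmnm i)).
  rewrite lincomb_cons lincomb_map.
  set x := _ *: _; rewrite (_ : _ - _ = p - (x + emb q) + emb (q - lincomb c s)).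
    apply: (subspaceD (subspace_Ann _)); first exact: mixed_contract.
    exact/Ann_split_emb.
  by rewrite raddfB /= !opprD !addrA subrK.
Qed.

(** The form [q0] replaces [w^i] modulo the annihilator, so no class is added. Degrees [0], [j] and
    above [j] are treated together, with different [q0]. *)
Lemma split_basis_end (K : fieldType) j (G : {mpoly K[3]}) a i s q0 :
  (0 < j)%N -> is_homog j G -> G != 0 -> a != 0 ->
  is_homog i q0 -> Ann (split_dual j G a) (vw ^+ i - emb q0) ->
  homog_basis_mod (Ann G) i s ->
  homog_basis_mod (Ann (split_dual j G a)) i (map (@emb K) s).
Proof.
move=> j0 Gj G0 a0 q0i q0F [si indep span_s].
split=> [p /mapP[q qs ->]|c|p pi]; first exact/emb_homog/si.
  by rewrite lincomb_map size_map => /(Ann_split_emb _ j0 Gj G0 a0)/indep.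
have [qi r_mixed] := homog_reduce pi; set q := res _ in qi r_mixed.
pose b := p@_(wmnm i).
have [|c cG] := span_s (b *: q0 + q).
  by case: (@subspace_homog K 3 i) => _; apply.
exists c; rewrite lincomb_map.
rewrite (_ : _ - _ = p - (b *: vw ^+ i + emb q) + (b *: (vw ^+ i - emb q0) +
    emb (b *: q0 + q - lincomb c s))).
  apply: (subspaceD (subspace_Ann _)); first exact: mixed_contract.
  by case: (subspace_Ann (split_dual j G a)) => _; apply=> //; apply/Ann_split_emb.
rewrite (raddfB (@emb K)) (raddfD (@emb K)) /= embZ scalerBr !opprD !addrA.
by rewrite subrK [X in _ = X - _]addrAC subrK subrK.
Qed.

Lemma hilb_split_mid (K : fieldType) j (G : {mpoly K[3]}) a i m :
  is_homog j G -> G != 0 -> a != 0 -> (0 < i < j)%N ->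
  hilb_at (Ann (split_dual j G a)) i m <->
  exists m', m = m'.+1 /\ hilb_at (Ann G) i m'.
Proof.
move=> Gj G0 a0 ij; have [s sB] := exists_homog_basis_mod i (subspace_Ann G).
have sH := hilb_at_basis (subspace_Ann G) sB.
have := hilb_at_basis (subspace_Ann _) (split_basis_mid Gj G0 a0 ij sB).
rewrite /= size_map => FH; split=> [mH|[m' [-> m'H]]].
  by exists (size s); split=> //; apply: hilb_at_inj mH FH.
by rewrite (hilb_at_inj m'H sH).
Qed.

Lemma hilb_split_end (K : fieldType) j (G : {mpoly K[3]}) a i m :
  (0 < j)%N -> is_homog j G -> G != 0 -> a != 0 -> (i == 0)%N || (j <= i)%N ->
  hilb_at (Ann (split_dual j G a)) i m <-> hilb_at (Ann G) i m.
Proof.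
move=> j0 Gj G0 a0 ij; have [s sB] := exists_homog_basis_mod i (subspace_Ann G).
have sH := hilb_at_basis (subspace_Ann G) sB.
(* [q0] is [1] in degree [0], the socle generator [g] in degree [j], and [0] above [j], where every
   form kills the dual generator. *)
have [q0 [q0i q0F]] : exists q0, is_homog i q0 /\
    Ann (split_dual j G a) (vw ^+ i - emb q0).
  case/orP: ij => [/eqP->|].
    exists 1; split; first by rewrite is_homog_dhomog dhomog1.
    by rewrite expr0 rmorph1 subrr /Ann contract0l.
  rewrite leq_eqVlt => /orP[/eqP<-|ji].
    have [g [gj gG]] := exists_socle_gen a Gj G0.
    by exists g; split=> //; apply: Ann_split_socle.
  exists 0; rewrite raddf0 subr0; split; first by rewrite is_homog_dhomog rpred0.
  exact: Ann_homog_gt (split_homog a Gj) ji (vwX_homog K i).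
have := hilb_at_basis (subspace_Ann _) (split_basis_end j0 Gj G0 a0 q0i q0F sB).
rewrite size_map => FH; split=> mH.
  by rewrite (hilb_at_inj mH FH).
by rewrite (hilb_at_inj mH sH).
Qed.

(** * Graded pieces of the inverse system *)

Lemma perp_top (K : fieldType) n j (F G0 : {mpoly K[n]}) :
  is_homog j F -> is_homog j G0 ->
  (forall h, Ann F h -> contract h G0 = 0) <-> exists c : K, G0 = c *: F.
Proof.
move=> Fj G0j; split=> [/perp_Ann[q G0E]|[c ->] h hF]; last first.
  by rewrite contractZr hF scaler0.
(* In the top degree [j] only the constant term of [q] contributes to [q o F]. *)
exists q@_0; rewrite -contractCl -pihomog_deg0 -(@pihomog_contract _ _ 0 j) // -G0E.
by rewrite pihomog_dE // -is_homog_dhomog.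
Qed.

Lemma perp_above (K : fieldType) n j i (F G0 : {mpoly K[n]}) :
  is_homog j F -> (j < i)%N -> is_homog i G0 ->
  (forall h, Ann F h -> contract h G0 = 0) -> G0 = 0.
Proof.
move=> Fj ji G0i /perp_Ann[q G0E]; apply/mpolyP => v; rewrite mcoeff0.
have [vi|vi] := eqVneq (mdeg v) i; last exact: is_homog_coeff0 G0i vi.
rewrite G0E mcoeff_contract big1_seq // => m _.
rewrite (is_homog_coeff0 (m := (m + v)%MM) Fj) ?mulr0 // mdegD vi.
by rewrite gtn_eqF // (leq_trans ji) ?leq_addl.
Qed.

Lemma pihomog_emb (K : fieldType) d (p : {mpoly K[3]}) :
  pihomog mdeg d (emb p) = emb (pihomog mdeg d p).
Proof.
apply/mpolyP => m; rewrite mcoeff_pihomog !mcoeff_emb mcoeff_pihomog.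
case: (m ord0 =P 0%N) => [m0|_]; last by case: ifP.
by rewrite mdeg_mnm4 m0.
Qed.

(** An operator of positive degree [j - i] can be prescribed independently on the two summands: its
    part free of [w] acts on [G] alone and its [w^(j-i)] term on [W^[j]] alone. For [i = j] both
    actions are tied to the same constant. *)
Lemma inverse_system_split (K : fieldType) j (G : {mpoly K[3]}) a i G0 :
  is_homog j G -> a != 0 -> (i < j)%N -> is_homog i G0 ->
  (exists h, G0 = contract h (split_dual j G a)) <->
  exists (h' : {mpoly K[3]}) (b : K), G0 = emb (contract h' G) + b *: Wdp K i.
Proof.
move=> Gj a0 ij G0i; have ji : (j - i + i)%N = j by rewrite subnK // ltnW.
have Gji : is_homog (j - i + i) G by rewrite ji.
split=> [[h G0E]|[h' [b G0E]]].
  exists (res (pihomog mdeg (j - i) h)).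
  exists (a * (pihomog mdeg (j - i) h)@_(wmnm (j - i))).
  have := contract_split_homog G a (leq_subr i j) (homog_pihomog (j - i) h).
  rewrite subKn 1?ltnW // => <-.
  rewrite -(@pihomog_contract _ _ _ i) -?G0E ?ji ?split_homog //.
  by rewrite pihomog_id_homog.
have h2 := homog_pihomog (j - i) h'; set q := pihomog _ _ _ in h2.
(* [h'] is cut down to its part [q] of degree [j - i], the only one contributing in degree [i];
   dividing by [a] offsets the coefficient of [W^[j]]. *)
exists (emb q + (b / a) *: vw ^+ (j - i)).
have ji0 : (j - i == 0)%N = false by rewrite subn_eq0 leqNgt ij.
rewrite (@contract_split_homog _ _ _ _ (j - i)) ?leq_subr //; last first.
  apply: (subspaceD (@subspace_homog K 4 _)); first exact: emb_homog.
  exact: (subspaceZ _ (@subspace_homog K 4 _)) (vwX_homog K _).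
rewrite subKn 1?ltnW // raddfD /= embK resZ rmorphXn /= res_vw expr0n ji0 scaler0 addr0.
rewrite mcoeffD mcoeff_emb_wmnm ji0 add0r mcoeffZ vwXE mcoeffX eqxx mulr1.
rewrite mulrCA mulfV // mulr1 -(pihomog_id_homog G0i) G0E raddfD /= pihomog_emb.
by rewrite (@pihomog_contract _ _ (j - i)) // -/q (pihomog_id_homog (subspaceZ _ (subspace_homog _ _ _) (Wdp_homog _ _))).
Qed.

(** * Minimal generators *)

Lemma mem_take_drop (T : eqType) (x0 : T) i (s : seq T) p : (i < size s)%N ->
  p \in take i s ++ drop i.+1 s <->
  exists k, [/\ (k < size s)%N, k != i & p = nth x0 s k].
Proof.
move=> lt_i; have sz : size (take i s) = i by rewrite size_take lt_i.
rewrite mem_cat; split=> [/orP[] /(nthP x0)[k]|[k [ks ki ->]]].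
- rewrite sz => ki <-; exists k; rewrite nth_take //.
  by rewrite (ltn_trans ki lt_i) (ltn_eqF ki).
- rewrite size_drop ltn_subRL => ki <-; exists (i.+1 + k)%N; rewrite nth_drop ki.
  by split=> //; rewrite gtn_eqF // ltn_addr.
apply/orP; case: (ltngtP k i) ki => // [ki|ik] _; [left|right].
  by rewrite -(nth_take x0 ki) mem_nth ?sz.
rewrite -(subnKC ik) -nth_drop mem_nth // size_drop ltn_sub2r //.
exact: leq_ltn_trans ik ks.
Qed.

Lemma pihomogM (K : fieldType) n d e (b g : {mpoly K[n]}) : is_homog e g ->
  pihomog mdeg d (b * g) = if (e <= d)%N then pihomog mdeg (d - e) b * g else 0.
Proof.
move=> ge; rewrite [b in LHS]mpolyE mulr_suml raddf_sum /=.
have term m : pihomog mdeg d (b@_m *: 'X_[m] * g) =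
    if (mdeg m + e == d)%N then b@_m *: 'X_[m] * g else 0.
  have mge : is_homog (mdeg m + e) (b@_m *: 'X_[m] * g).
    by apply: is_homogM ge; apply: (subspaceZ _ (@subspace_homog K n _)) (homogX K m).
  case: eqP => [<-|/eqP med]; first by rewrite pihomog_id_homog.
  by rewrite (pihomog_ne0 (d := (mdeg m + e)%N)) // -is_homog_dhomog.
rewrite (eq_bigr _ (fun m _ => term m)); case: leqP => [ed|de].
  rewrite pihomogE mulr_suml -big_mkcond /=; apply: eq_bigl => m.
  by rewrite -[RHS](eqn_add2r e) subnK.
rewrite big1 // => m _; rewrite gtn_eqF //.
by rewrite (leq_trans de) ?leq_addl.
Qed.

Lemma ideal_gen_by_pihomog (K : fieldType) n d (S : {mpoly K[n]} -> Prop) h :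
  (forall p, S p -> exists e, is_homog e p) ->
  ideal_gen_by S h -> ideal_gen_by S (pihomog mdeg d h).
Proof.
move=> Shom; pose I h := ideal_gen_by S (pihomog mdeg d h).
apply: (@ideal_gen_by_ind _ _ _ I) => [|p q|r p Sp]; rewrite /I.
- by rewrite raddf0; apply: ideal_gen_by0.
- by rewrite raddfD; apply: ideal_gen_byD.
- have [e pe] := Shom p Sp; rewrite (pihomogM _ _ pe).
  case: ifP => _; last exact: ideal_gen_by0.
  exact/ideal_gen_byM/ideal_gen_byS.
Qed.

Lemma ideal_gen_by_emb (K : fieldType) (S : {mpoly K[3]} -> Prop) T h :
  (forall p, S p -> T (emb p)) -> ideal_gen_by S h -> ideal_gen_by T (emb h).
Proof.
move=> ST; apply: (@ideal_gen_by_ind _ _ _ (fun h => ideal_gen_by T (emb h))).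
- by rewrite raddf0; apply: ideal_gen_by0.
- by move=> p q; rewrite raddfD; apply: ideal_gen_byD.
- by move=> r p Sp; rewrite rmorphM; apply/ideal_gen_byM/ideal_gen_byS/ST.
Qed.

Lemma is_homogXU (K : fieldType) n (i : 'I_n) : is_homog 1 ('X_i : {mpoly K[n]}).
Proof. by have := homogX K U_(i); rewrite mdeg1. Qed.

Lemma mpolyXU_neq0 (K : fieldType) n (i : 'I_n) : 'X_i != 0 :> {mpoly K[n]}.
Proof.
apply/eqP => /(congr1 (mcoeff U_(i))); rewrite mcoeff0 mcoeffX eqxx => /eqP.
by rewrite oner_eq0.
Qed.

(* Two independent forms are separated by a functional, so some [p] of degree
   [j - 1] has [p o (X_i o G) = 0] and [p o (X_k o G) = a]; then
   [X_i g = X_k (X_i p) - X_i (X_k p - g)]. *)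
Lemma socle_gen_mul (K : fieldType) n j (G g : {mpoly K[n]}) a (i k : 'I_n) :
  is_homog j.+1 G -> is_homog j.+1 g -> contract g G = a%:MP -> i != k ->
  (forall q, is_homog 1 q -> Ann G q -> q = 0) ->
  exists p q, [/\ is_homog j.+1 p, Ann G p, is_homog j.+1 q, Ann G q &
    'X_i * g = 'X_k * p - 'X_i * q].
Proof.
move=> Gj gj gG ik J1; pose A := contract 'X_i G; pose B := contract 'X_k G.
have Xj l : is_homog j (contract 'X_l G) by apply: contract_homog (is_homogXU K l) _.
have A0 : A != 0.
  apply/eqP => /J1 Xi0; case/negP: (mpolyXU_neq0 K i); apply/eqP/Xi0.
  exact: is_homogXU.
have [m Am] := nonzero_coeff A0; pose c := B@_m / A@_m.
pose B' := B - c *: A.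
have B'0 : B' != 0.
  apply/eqP; rewrite /B' /A /B -contractZl -contractBl => /J1 Xki.
  have : ('X_k - c *: 'X_i : {mpoly K[n]}) = 0.
    apply: Xki; apply: is_homogB; first exact: is_homogXU.
    exact: (subspaceZ _ (@subspace_homog K n 1)) (is_homogXU K i).
  move/(congr1 (mcoeff U_(k))); rewrite mcoeffB mcoeffZ !mcoeffX mcoeff0 eqxx.
  by rewrite eq_mnm1 (negPf ik) mulr0 subr0 => /eqP; rewrite oner_eq0.
have [m' B'm'] := nonzero_coeff B'0.
have B'm : B'@_m = 0 by rewrite mcoeffB mcoeffZ mulfVK ?subrr.
have mj : mdeg m = j by apply: (is_homogP (Xj i)).
have B'j : is_homog j B'.
  apply: is_homogB; first exact: Xj.
  exact: (subspaceZ _ (@subspace_homog K n j)) (Xj i).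
have m'j : mdeg m' = j by apply: (is_homogP B'j).
pose p0 : {mpoly K[n]} := 'X_[m'] - (A@_m' / A@_m) *: 'X_[m].
have p0j : is_homog j p0.
  apply: is_homogB; first by rewrite -{1}m'j homogX.
  by apply: (subspaceZ _ (@subspace_homog K n j)); rewrite -{1}mj homogX.
have p0E (H : {mpoly K[n]}) : is_homog j H ->
    contract p0 H = (H@_m' - A@_m' / A@_m * H@_m)%:MP.
  move=> Hj; have p0H : is_homog 0 (contract p0 H).
    by apply: contract_homog p0j _; rewrite addn0.
  rewrite -(pihomog_id_homog p0H) pihomog_deg0 contractBl contractZl.
  by rewrite mcoeffB mcoeffZ !mcoeff_contractX !addm0.
have p0A : contract p0 A = 0 by rewrite (p0E A (Xj i)) mulfVK // subrr raddf0.
have p0B : contract p0 B = (B'@_m')%:MP.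
  rewrite -[B](subrK (c *: A)) -/B' raddfD /= contractZr p0A scaler0 addr0.
  by rewrite p0E // B'm mulr0 subr0.
pose p := (a / B'@_m') *: p0.
have pj : is_homog j p by apply: (subspaceZ _ (@subspace_homog K n j)).
have Xp l : is_homog j.+1 ('X_l * p) by apply: is_homogM (is_homogXU K l) pj.
exists ('X_i * p), ('X_k * p - g); split=> //.
- by rewrite /Ann [_ * p]mulrC contractM contractZl p0A scaler0.
- exact: is_homogB.
- rewrite /Ann contractBl gG [_ * p]mulrC contractM contractZl p0B.
  by rewrite -mul_mpolyC -rmorphM /= mulfVK // subrr.
- by rewrite mulrBr opprB mulrCA addrC subrK.
Qed.

Definition wxyz_mnm (i : 'I_3) : 'X_{1..4} := (wmnm 1 + mnm_emb U_(i))%MM.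

Lemma wxyz_mnmE (K : fieldType) i :
  vw * emb 'X_i = 'X_[wxyz_mnm i] :> {mpoly K[4]}.
Proof. by rewrite vwE embX mpolyXD. Qed.

Lemma mdeg_wxyz_mnm i : mdeg (wxyz_mnm i) = 2%N.
Proof. by rewrite mdegD mdeg_wmnm mdeg_emb mdeg1. Qed.

Lemma wxyz_homog (K : fieldType) i : is_homog 2 ('X_[wxyz_mnm i] : {mpoly K[4]}).
Proof. by have := homogX K (wxyz_mnm i); rewrite mdeg_wxyz_mnm. Qed.

Lemma wxyz_mnm_inj : injective wxyz_mnm.
Proof.
move=> i k /addmI/(congr1 mnm_res); rewrite !mnm_embK => /eqP.
by rewrite eq_mnm1 => /eqP.
Qed.

Lemma contractXX (K : fieldType) n (m u : 'X_{1..n}) : mdeg m = mdeg u ->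
  contract 'X_[m] 'X_[u] = (m == u)%:R%:MP :> {mpoly K[n]}.
Proof.
move=> mu; have h0 : is_homog 0 (contract 'X_[m] 'X_[u] : {mpoly K[n]}).
  by apply: contract_homog (homogX K m) _; rewrite addn0 mu homogX.
by rewrite -(pihomog_id_homog h0) pihomog_deg0 mcoeff_contractX addm0 mcoeffX eq_sym.
Qed.

Definition extra_gens (K : fieldType) j (g : {mpoly K[3]}) : seq {mpoly K[4]} :=
  [:: vw * vx; vw * vy; vw * vz; vw ^+ j - emb g].

Lemma extra_gensE (K : fieldType) j (g : {mpoly K[3]}) k : (k < 4)%N ->
  (exists i : 'I_3, k = i /\ (extra_gens j g)`_k = vw * emb 'X_i) \/
  k = 3%N /\ (extra_gens j g)`_k = vw ^+ j - emb g.
Proof.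
rewrite /extra_gens; have [<- <- <-] := emb_vars K.
case: k => [|[|[|[|//]]]] _; last by right.
- by left; exists 0.
- by left; exists 1.
- by left; exists (inord 2); rewrite inordK.
Qed.

Section SplitMinimalGens.
Variables (K : fieldType) (j : nat) (G g : {mpoly K[3]}) (a : K).
Hypotheses (j2 : (2 < j)%N) (Gj : is_homog j G) (G0 : G != 0) (a0 : a != 0).
Hypotheses (gj : is_homog j g) (gG : contract g G = a%:MP).
Hypothesis J2 : forall q, is_homog 2 q -> Ann G q -> q = 0.

Let j0 : (0 < j)%N. Proof. exact: ltn_trans j2. Qed.

Lemma Ann_linear_eq0 q : is_homog 1 q -> Ann G q -> q = 0.
Proof.
move=> q1 qG; have /J2 : is_homog 2 ('X_ord0 * q : {mpoly K[3]}).
  exact: is_homogM (is_homogXU K _) q1.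
move/(_ (Ann_mull _ qG))/eqP; rewrite mulf_eq0 (negPf (mpolyXU_neq0 K _)).
by move/eqP.
Qed.

Lemma Ann_low_eq0 d q : (d <= 2)%N -> is_homog d q -> Ann G q -> q = 0.
Proof.
case: d => [|[|[|//]]] _ qd qG; [| exact: Ann_linear_eq0 | exact: J2].
by rewrite -(pihomog_id_homog qd) pihomog_deg0 (Ann_coeff0 Gj G0 qG) raddf0.
Qed.

Lemma extra_gen_irredundant (s : seq {mpoly K[3]}) l :
  (forall p, p \in s -> Ann G p) -> (forall p, p \in s -> exists d, is_homog d p) ->
  (l < 4)%N -> exists U : {mpoly K[4]},
    [/\ forall p, p \in s -> Ann U (emb p),
        forall k, (k < 4)%N -> k != l -> Ann U (extra_gens j g)`_k &
        ~ Ann U (extra_gens j g)`_l].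
Proof.
move=> sG sh l4; have [[i [lE lg]]|[lE lg]] := extra_gensE j g l4.
  have Uh := wxyz_homog K i.
  (* This is the quadric [W X_i]. Generators of [Ann G] of degree at most [2] are zero, and those of
     higher degree kill it, as does [w^j - g] since [2 < j]. *)
  exists 'X_[wxyz_mnm i]; split=> [p ps|k k4 kl|].
  - have [d pd] := sh p ps; have [d2|d2] := leqP d 2.
      by rewrite (Ann_low_eq0 d2 pd (sG p ps)) raddf0 /Ann contract0l.
    exact: Ann_homog_gt Uh d2 (emb_homog pd).
  - have [[i' [kE ->]]|[_ ->]] := extra_gensE j g k4.
      rewrite wxyz_mnmE /Ann contractXX ?mdeg_wxyz_mnm // (inj_eq wxyz_mnm_inj).
      by case: eqP => [ii|_]; rewrite ?raddf0 //; rewrite kE lE ii eqxx in kl.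
    by apply: Ann_homog_gt Uh j2 _; apply: is_homogB (vwX_homog K j) (emb_homog gj).
  - rewrite lg wxyz_mnmE /Ann contractXX // eqxx => /eqP.
    by rewrite mpolyC_eq0 oner_eq0.
(* This is [W^[j]]; elements of [Ann G] kill it since they have no constant term. *)
exists (split_dual j 0 1); split=> [p ps|k k4 kl|].
- rewrite /Ann contract_split raddf0 raddf0 add0r scale1r big1 // => k _.
  by rewrite mcoeff_emb_wmnm (Ann_coeff0 Gj G0 (sG p ps)); case: ifP; rewrite scale0r.
- have [[i' [_ ->]]|[kE _]] := extra_gensE j g k4; last by rewrite kE lE in kl.
  exact/mixed_contract/mixed_wxyz.
- have wgj : is_homog j (vw ^+ j - emb g).
    exact: is_homogB (vwX_homog K j) (emb_homog gj).
  rewrite lg /Ann (contract_split_homog _ _ (leqnn j) wgj) raddf0 raddf0 add0r mul1r.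
  rewrite mcoeffB vwXE mcoeffX eqxx mcoeff_emb_wmnm (gtn_eqF j0) subr0 scale1r.
  rewrite subnn WdpE mpolyX0 => /eqP.
  by rewrite oner_eq0.
Qed.

(** Setting [w = 0] in a redundancy relation puts [s_i] in the ideal [O] of the other generators up
    to a multiple [b g]. In degree [d] of [s_i] this error is absent if [d < j], and a scalar
    multiple of [g], hence zero, if [d = j]. Only [d > j] needs the inclusion of every [x_l g] in
    [O]. *)
Lemma emb_gen_irredundant (s : seq {mpoly K[3]}) i :
  minimal_gens (Ann G) s -> (i < size s)%N ->
  ~ ideal_gen_by (fun p => (exists k, [/\ (k < size s)%N, k != i & p = emb s`_k]) \/
      exists k, (k < 4)%N /\ p = (extra_gens j g)`_k) (emb s`_i).
Proof.
move=> [sh [sG smin]] lt_i emb_si.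
pose O := ideal_gen_by (fun p => p \in take i s ++ drop i.+1 s).
have Ok k : (k < size s)%N -> k != i -> O s`_k.
  by move=> ks ki; apply/ideal_gen_byS/(mem_take_drop 0 _ lt_i); exists k.
have Ohom p : p \in take i s ++ drop i.+1 s -> exists e, is_homog e p.
  by case/(mem_take_drop 0 _ lt_i) => k [ks _ ->]; apply/sh/mem_nth.
have O_pihomog d h : O h -> O (pihomog mdeg d h) by apply: ideal_gen_by_pihomog.
have OG p : O p -> Ann G p.
  apply: Ann_ideal_gen_by => q /(mem_take_drop 0 _ lt_i)[k [ks _ ->]].
  by apply/sG/ideal_gen_byS/mem_nth.
have [d sd] : exists d, is_homog d s`_i by apply/sh/mem_nth.
(* Under [res] the products [wx, wy, wz] vanish and [w^j - g] becomes [-g]. *)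
have [b Ob] : exists b, O (s`_i - b * g).
  rewrite -[s`_i]embK.
  apply: (@ideal_gen_by_ind _ _ _ (fun h => exists b, O (res h - b * g)))
    emb_si => [|p q [b Ob] [c Oc]|r p].
  - by exists 0; rewrite raddf0 mul0r subr0; apply: ideal_gen_by0.
  - exists (b + c); rewrite raddfD /= mulrDl opprD addrACA.
    exact: ideal_gen_byD.
  case=> [[k [ks ki ->]]|[k [k4 ->]]].
    exists 0; rewrite mul0r subr0 rmorphM /= embK.
    exact/ideal_gen_byM/Ok.
  have [[i' [_ ->]]|[_ ->]] := extra_gensE j g k4.
    exists 0; rewrite mul0r subr0 rmorphM /= (mixed_wxyz K i').1 mulr0.
    exact: ideal_gen_by0.
  exists (- res r); rewrite rmorphM rmorphB rmorphXn /= res_vw expr0n (gtn_eqF j0).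
  rewrite embK sub0r mulrN mulNr subrr; exact: ideal_gen_by0.
apply: (smin i lt_i); rewrite -/(O _).
have := O_pihomog d _ Ob; rewrite raddfB /= (pihomog_id_homog sd) (pihomogM _ _ gj).
case: (ltngtP j d) => [jd|dj|<-]; last 2 first.
- by rewrite subr0.
- rewrite subnn pihomog_deg0 => Ojb; suff b0 : b@_0 = 0.
    by rewrite b0 mpolyC0 mul0r subr0 in Ojb.
  have : Ann G (s`_i - (s`_i - (b@_0)%:MP * g)).
    apply: (subspaceB (subspace_Ann G)); last exact: OG.
    by apply/sG/ideal_gen_byS/mem_nth.
  rewrite opprB addrC subrK mul_mpolyC /Ann contractZl gG => /eqP.
  rewrite scaler_eq0 mpolyC_eq0 (negPf a0) orbF; exact: eqP.
(* As [s_i] has degree [d > j], it contributes nothing to degree [j], where the other generators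
   already give all of [Ann G]. *)
have OJ p : is_homog j p -> Ann G p -> O p.
  move=> pj /sG ps; rewrite -(pihomog_id_homog pj); move: ps.
  apply: (@ideal_gen_by_ind _ _ _ (fun p => O (pihomog mdeg j p))).
  - by rewrite raddf0; apply: ideal_gen_by0.
  - by move=> q r Oq Or; rewrite raddfD; apply: ideal_gen_byD.
  - move=> r q /(nthP 0)[k ks <-]; have [->|ki] := eqVneq k i.
      by rewrite (pihomogM _ _ sd) leqNgt jd; apply: ideal_gen_by0.
    exact/O_pihomog/ideal_gen_byM/Ok.
have OXg (l : 'I_3) : O ('X_l * g).
  have [l' ll'] : exists l' : 'I_3, l != l'.
    by have [->|l0] := eqVneq l 0; [exists 1 | exists 0].
  have jE : j.-1.+1 = j by rewrite prednK.
  have [||p [q [pj pG qj qG ->]]] :=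
    socle_gen_mul (j := j.-1) _ _ gG ll' Ann_linear_eq0; rewrite ?jE //.
  rewrite jE in pj qj.
  apply: ideal_gen_byD; first exact/ideal_gen_byM/OJ.
  by rewrite -mulrN; apply/ideal_gen_byM; rewrite -scaleN1r; apply/ideal_gen_byZ/OJ.
(* The multiplier of [g] has positive degree [d - j], so each of its monomials contains some [X_l],
   and [OXg] applies. *)
move=> Osi; rewrite -[s`_i](subrK (pihomog mdeg (d - j) b * g)).
apply: ideal_gen_byD => //; rewrite pihomogE mulr_suml.
rewrite big_mkcond; apply: ideal_gen_by_sum => m _; case: eqP => [md|_]; last exact: ideal_gen_by0.
have [l ml] : exists l, m l != 0%N.
  by apply: mnm_neq0; rewrite -mdeg_eq0 md subn_eq0 -ltnNge.
rewrite -scalerAl -(submK (m := U_(l)) (m' := m)) ?lep1mP //.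
by rewrite mpolyXD -mulrA; apply/ideal_gen_byZ/ideal_gen_byM/OXg.
Qed.

Lemma minimal_gens_split s : minimal_gens (Ann G) s ->
  minimal_gens (Ann (split_dual j G a)) (map (@emb K) s ++ extra_gens j g).
Proof.
move=> smin; have [sh [sG _]] := smin; set L := extra_gens j g.
have embG q : Ann (split_dual j G a) (emb q) <-> Ann G q by apply: Ann_split_emb.
have s_in p : p \in s -> Ann G p by move=> ps; apply/sG/ideal_gen_byS.
have nthL k : (k < size (map (@emb K) s ++ L))%N ->
    (k < size s)%N /\ (map (@emb K) s ++ L)`_k = emb s`_k \/
    exists l, [/\ (l < 4)%N, k = (size s + l)%N & (map (@emb K) s ++ L)`_k = L`_l].
  rewrite size_cat size_map nth_cat size_map => kS; case: ltnP => [ks|sk].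
    by left; rewrite (nth_map 0).
  by right; exists (k - size s)%N; rewrite -(ltn_add2l (size s)) subnKC.
split; last split.
- move=> p; rewrite mem_cat => /orP[/mapP[q /sh[d qd] ->]|].
    by exists d; apply: emb_homog.
  case/(nthP 0) => k k4 <-; have [[i [_ ->]]|[_ ->]] := extra_gensE j g k4.
    by exists 2%N; rewrite wxyz_mnmE wxyz_homog.
  by exists j; apply: is_homogB (vwX_homog K j) (emb_homog gj).
- move=> h; rewrite (Ann_split_gens h j0 Gj G0 a0 gj gG).
  have inL p : p \in L -> p \in map (@emb K) s ++ L by rewrite mem_cat orbC => ->.
  split; apply: ideal_gen_by_trans => p.
    case=> [[q [/embG/sG qs ->]]|pL].
      apply: ideal_gen_by_emb qs => r rs.
      by rewrite mem_cat (map_f (@emb K) rs).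
    apply/ideal_gen_byS/inL; rewrite !inE.
    by case: pL => [->|[->|[->|->]]]; rewrite eqxx ?orbT.
  rewrite mem_cat => pE; apply: ideal_gen_byS; case/orP: pE => [/mapP[q qs ->]|].
    by left; exists q; split=> //; apply/embG/s_in.
  by rewrite !inE => /or4P[] /eqP->; right; [left|right; left|right; right; left|do 3 right].
- move=> i lt_i; have [[ls ->]|[l [l4 lE ->]]] := nthL i lt_i.
    move=> si; apply: (emb_gen_irredundant smin ls).
    apply: ideal_gen_by_trans si => p /(mem_take_drop 0 _ lt_i)[k [ks ki ->]].
    apply: ideal_gen_byS; have [[k_s ->]|[l [l4 _ ->]]] := nthL k ks.
      by left; exists k.
    by right; exists l.
  have [U [sU LU nU]] := extra_gen_irredundant s_in sh l4.
  move=> Ll; apply: nU; apply: Ann_ideal_gen_by Ll => p.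
  case/(mem_take_drop 0 _ lt_i) => k [ks ki ->].
  have [[k_s ->]|[l' [l'4 kE ->]]] := nthL k ks; first exact/sU/mem_nth.
  by apply: LU => //; apply: contraNneq ki => ll'; rewrite kE lE ll'.
Qed.

End SplitMinimalGens.

(** * Linear changes of coordinates *)

Definition coord_vars (K : fieldType) (M : 'M[K]_4) : 4.-tuple {mpoly K[4]} :=
  [tuple \sum_(k < 4) M i k *: 'X_k | i < 4].

HB.instance Definition _ (K : fieldType) (M : 'M[K]_4) :=
  GRing.RMorphism.copy (coord_change M) (comp_mpoly (coord_vars M)).
HB.instance Definition _ (K : fieldType) (M : 'M[K]_4) :=
  GRing.Linear.copy (coord_change M) (comp_mpoly (coord_vars M)).

Lemma coord_changeX (K : fieldType) (M : 'M[K]_4) m :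
  coord_change M 'X_[m] = \prod_(i < 4) (\sum_(k < 4) M i k *: 'X_k) ^+ m i.
Proof.
rewrite /coord_change comp_mpolyX; apply: eq_bigr => i _.
by rewrite tnth_mktuple.
Qed.

Lemma coord_changeZ (K : fieldType) (M : 'M[K]_4) c p :
  coord_change M (c *: p) = c *: coord_change M p.
Proof. exact: comp_mpolyZ. Qed.

Lemma coord_changeXU (K : fieldType) (M : 'M[K]_4) i :
  coord_change M 'X_i = \sum_(k < 4) M i k *: 'X_k.
Proof. by rewrite /coord_change comp_mpolyXU -tnth_nth tnth_mktuple. Qed.

Lemma coord_changeE (K : fieldType) (M : 'M[K]_4) p :
  coord_change M p = \sum_(m <- msupp p) p@_m *: coord_change M 'X_[m].
Proof.
rewrite {1}[p]mpolyE (raddf_sum (coord_change M)); apply: eq_bigr => m _.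
by rewrite /= coord_changeZ.
Qed.

(** Substituting by [M] and then by [N] sends the variable of index [i] to row [i] of [M *m N], so
    the factors stand in the order of substitution. *)
Lemma coord_changeK (K : fieldType) (M N : 'M[K]_4) :
  M *m N = 1%:M -> cancel (coord_change M) (coord_change N).
Proof.
move=> MN p; rewrite [in RHS](mpolyE p) (coord_changeE M) (raddf_sum (coord_change N)).
apply: eq_bigr => m _; rewrite /= coord_changeZ; congr (_ *: _).
rewrite coord_changeX rmorph_prod mpolyXE_id; apply: eq_bigr => i _.
rewrite rmorphXn; congr (_ ^+ _); rewrite raddf_sum /=.
under eq_bigr => k _ do rewrite coord_changeZ coord_changeXU scaler_sumr.
rewrite exchange_big (bigD1 i) //= [X in _ + X]big1 ?addr0 => [|l li].
  under eq_bigr => k _ do rewrite scalerA.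
  rewrite -scaler_suml; have /matrixP/(_ i i) := MN; rewrite !mxE eqxx => ->.
  by rewrite scale1r.
under eq_bigr => k _ do rewrite scalerA.
rewrite -scaler_suml; have /matrixP/(_ i l) := MN.
by rewrite !mxE eq_sym (negPf li) => ->; rewrite scale0r.
Qed.

Lemma coord_change1 (K : fieldType) (p : {mpoly K[4]}) : coord_change 1%:M p = p.
Proof.
rewrite -[RHS]comp_mpoly_id; congr comp_mpoly; apply: eq_from_tnth => i.
rewrite !tnth_mktuple (bigD1 i) //= mxE eqxx scale1r big1 ?addr0 // => k ki.
by rewrite mxE eq_sym (negPf ki) scale0r.
Qed.

Lemma is_homog_sum (K : fieldType) n d (T : eqType) (r : seq T) (f : T -> {mpoly K[n]}) :
  (forall i, i \in r -> is_homog d (f i)) -> is_homog d (\sum_(i <- r) f i).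
Proof.
move=> fd; rewrite big_seq; apply: (big_ind (fun p => is_homog d p)) => //.
  by case: (@subspace_homog K n d).
by move=> p q; apply: subspaceD (@subspace_homog K n d).
Qed.

Lemma coord_change_homog (K : fieldType) (M : 'M[K]_4) d p :
  is_homog d p -> is_homog d (coord_change M p).
Proof.
move=> pd; rewrite coord_changeE; apply: is_homog_sum => m; rewrite mcoeff_msupp.
move/(is_homogP pd) => <-; apply: (subspaceZ _ (@subspace_homog K 4 _)).
rewrite coord_changeX mdegE.
apply: (big_ind2 (fun d p => is_homog d p)) => [|d1 p1 d2 p2|i _].
- by rewrite is_homog_dhomog dhomog1.
- exact: is_homogM.
- have L1 : is_homog 1 (\sum_(k < 4) M i k *: 'X_k : {mpoly K[4]}).
    apply: is_homog_sum => k _; apply: (subspaceZ _ (@subspace_homog K 4 _)).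
    exact: is_homogXU.
  by rewrite is_homog_dhomog in L1 *; have := dhomogMn (m i) L1; rewrite mul1n.
Qed.

(* [F'] is determined by its pairing [p |-> (coord_change N p o F)_0]; this
   avoids transporting divided powers along the change of coordinates. *)
Lemma coord_change_dual (K : fieldType) (M N : 'M[K]_4) j F :
  M *m N = 1%:M -> N *m M = 1%:M -> AG_dual j F ->
  exists F', AG_dual j F' /\ forall h, Ann F' h <-> Ann F (coord_change N h).
Proof.
move=> MN NM [Fj F0].
pose E m := (contract (coord_change N 'X_[m]) F)@_0.
have Eneq m : mdeg m != j -> E m = 0.
  move=> mj; have hm := coord_change_homog N (homogX K m).
  have [jm|mj'] := ltnP j (mdeg m); first by rewrite /E (contract_homog_gt jm hm Fj) mcoeff0.
  have : is_homog (j - mdeg m) (contract (coord_change N 'X_[m]) F).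
    by apply: contract_homog hm _; rewrite subnKC.
  move=> hF; rewrite /E (is_homog_coeff0 hF) // mdeg0 eq_sym subn_eq0 -ltnNge.
  by rewrite ltn_neqAle mj mj'.
pose F' : {mpoly K[4]} := \sum_(m : 'X_{1..4 < j.+1}) E m *: 'X_[m].
have F'E m : F'@_m = E m.
  case: (ltnP (mdeg m) j.+1) => [mj|jm]; first exact: mcoeff_mpoly.
  rewrite Eneq ?gtn_eqF // raddf_sum big1 // => u _ /=.
  rewrite mcoeffZ mcoeffX; case: eqP => [um|_]; rewrite ?mulr0 //.
  by have := bmdeg u; rewrite um ltnNge jm.
have F'_pair p : (contract p F')@_0 = (contract (coord_change N p) F)@_0.
  rewrite mcoeff_contract coord_changeE contract_suml raddf_sum; apply: eq_bigr => m _.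
  by rewrite /= contractZl mcoeffZ addm0 F'E.
have F'_Ann h : Ann F' h <-> Ann F (coord_change N h).
  rewrite !Ann_pairing; split=> hF q.
    by rewrite -[q](coord_changeK MN) -rmorphM -F'_pair.
  by rewrite F'_pair rmorphM.
exists F'; split=> //; split.
  apply/is_homogP => m; rewrite F'E; apply: contraNeq => mj.
  by rewrite Eneq.
apply: contraNneq F0 => F'0; have : Ann F' 1 by rewrite F'0 /Ann raddf0.
by rewrite F'_Ann rmorph1 /Ann contract1 => ->.
Qed.

Lemma hilb_coord_change (K : fieldType) (M N : 'M[K]_4) F F' i m :
  M *m N = 1%:M -> N *m M = 1%:M ->
  (forall h, Ann F' h <-> Ann F (coord_change N h)) ->
  hilb_at (Ann F) i m -> hilb_at (Ann F') i m.
Proof.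
move=> MN NM F'_Ann Fm; have [s sB] := exists_homog_basis_mod i (subspace_Ann F).
have [si indep span_s] := sB.
rewrite (hilb_at_inj Fm (hilb_at_basis (subspace_Ann F) sB)).
rewrite -(size_map (coord_change M) s); apply: hilb_at_basis (subspace_Ann F') _.
split=> [p /mapP[q qs ->]|c|p pi]; first exact/coord_change_homog/si.
  by rewrite lincomb_map size_map => /F'_Ann; rewrite (coord_changeK MN) => /indep.
have [c cF] := span_s _ (coord_change_homog N pi); exists c.
by rewrite lincomb_map; apply/F'_Ann; rewrite raddfB /= (coord_changeK MN).
Qed.

(** * Socle degrees *)

Lemma hilb_above (K : fieldType) n j i m (F : {mpoly K[n.+1]}) :
  is_homog j F -> (j < i)%N -> hilb_at (Ann F) i m -> m = 0%N.
Proof.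
move=> Fj ji Fm; apply: hilb_at_inj Fm _.
apply: (hilb_at_basis (s := [::]) (subspace_Ann F)); split=> // p pi.
by exists (fun=> 0); rewrite /lincomb big_ord0 subr0; apply: Ann_homog_gt Fj ji pi.
Qed.

(** If every form of degree [i <= j] killed [F], so would every monomial of degree [j], including
    one on which [F] has a nonzero coefficient. *)
Lemma hilb_pos (K : fieldType) n j i m (F : {mpoly K[n.+1]}) :
  AG_dual j F -> (i <= j)%N -> hilb_at (Ann F) i m -> (0 < m)%N.
Proof.
move=> [Fj F0] ij Fm; have [[|p s] sB] := exists_homog_basis_mod i (subspace_Ann F).
  have [_ _ span_s] := sB; have XF k : forall u, mdeg u = (i + k)%N -> Ann F 'X_[u].
    elim: k => [|k IHk] u uk.
      have [|c] := span_s 'X_[u]; first by rewrite -[i]addn0 -uk homogX.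
      by rewrite /lincomb big_ord0 subr0.
    have [l ul] : exists l, u l != 0%N.
      by apply: mnm_neq0; rewrite -mdeg_eq0 uk addnS.
    have uE : (u - U_(l) + U_(l))%MM = u by rewrite submK // lep1mP.
    rewrite -uE mpolyXD mulrC; apply/Ann_mull/IHk/eqP.
    by rewrite -(eqn_add2r 1) -{1}(mdeg1 l) -mdegD uE uk addn1 addnS.
  have [u Fu] := nonzero_coeff F0; have uj := is_homogP Fj u Fu.
  case/eqP: Fu; rewrite -[u]addm0 -mcoeff_contractX.
  by rewrite (XF (j - i)%N) ?mcoeff0 // uj subnKC.
by rewrite (hilb_at_inj Fm (hilb_at_basis (subspace_Ann F) sB)).
Qed.

(** The socle degree is the last degree where the Hilbert function is nonzero, so agreement from [j]
    on is enough. [in_C] and [gor_seq] leave that degree existential; this pins it to [j]. *)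
Lemma socle_degree_uniq (K L : fieldType) n k j d (F : {mpoly K[n.+1]})
    (G : {mpoly L[k.+1]}) (H H' : nat -> nat) :
  AG_dual j F -> AG_dual d G -> hilb_fun (Ann F) H -> hilb_fun (Ann G) H' ->
  (forall i, (j <= i)%N -> H' i = H i) -> d = j.
Proof.
move=> Fj Gd FH GH HH'; case: (ltngtP d j) => // [dj|jd].
  have := hilb_pos Fj (leqnn j) (FH j).
  by rewrite -HH' // (hilb_above Gd.1 dj (GH j)).
have := hilb_pos Gd (leqnn d) (GH d).
by rewrite HH' ?(ltnW jd) // (hilb_above Fj.1 jd (FH d)).
Qed.

(** * Algebras with I_2 = <wx, wy, wz> *)

Lemma exists_split_dual (K : fieldType) j (F : {mpoly K[4]}) :
  (2 < j)%N -> AG_dual j F ->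
  (forall p, is_homog 2 p -> (Ann F p <-> in_span_wxyz p)) ->
  exists G a, [/\ is_homog j G, G != 0, a != 0, F = split_dual j G a &
    forall q, is_homog 2 q -> Ann G q -> q = 0].
Proof.
move=> j2 [Fj F0] I2; have j0 : (0 < j)%N by apply: ltn_trans j2.
have [|G [a [Gj FE]]] := (perp_wxyz j0 Fj).1.
  move=> h; apply: Ann_ideal_gen_by => p /wxyzP[i ->].
  apply/I2; first by rewrite wxyz_mnmE wxyz_homog.
  apply/in_span_wxyzP; exists (fun k => (k == i)%:R).
  rewrite (bigD1 i) //= eqxx scale1r big1 ?addr0 // => k ki.
  by rewrite (negPf ki) scale0r.
(* A quadric free of [w] that kills [F] is a combination of [wx, wy, wz], so it vanishes on setting
   [w = 0]. *)
have I2_res q : is_homog 2 q -> Ann F (emb q) -> q = 0.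
  by move=> q2 /(I2 _ (emb_homog q2))/mixed_span[]; rewrite embK.
have G0 : G != 0.
  have x2 : is_homog 2 ('X_0 * 'X_0 : {mpoly K[3]}).
    exact: is_homogM (is_homogXU K _) (is_homogXU K _).
  apply/eqP => G0; have /eqP : ('X_0 * 'X_0 : {mpoly K[3]}) = 0.
    apply: I2_res => //; rewrite FE G0 /Ann contract_split embK raddf0 raddf0 add0r.
    rewrite big1 ?scaler0 // => k _; rewrite mcoeff_emb_wmnm.
    rewrite (is_homog_coeff0 (m := 0%MM) x2) ?mdeg0 //.
    by case: ifP; rewrite scale0r.
  by rewrite mulf_eq0 orbb (negPf (mpolyXU_neq0 K _)).
have a0 : a != 0.
  apply/eqP => a0; have /(I2 _ (vwX_homog K 2))/mixed_span[_] : Ann F (vw ^+ 2).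
    rewrite FE /Ann (contract_split_homog G a (ltnW j2) (vwX_homog K 2)) a0 mul0r.
    by rewrite scale0r addr0 rmorphXn /= res_vw expr0n contract0l raddf0.
  rewrite rmorphXn /= wpart_vw => /eqP; rewrite expf_eq0 /=.
  by rewrite polyX_eq0.
exists G, a; split=> // q q2 qG; apply: I2_res q2 _.
by rewrite FE; apply/Ann_split_emb.
Qed.

Lemma mixed_quadric (K : fieldType) (p : {mpoly K[4]}) :
  mixed p -> is_homog 2 p -> in_span_wxyz p.
Proof.
move=> p_mixed p2; apply/in_span_wxyzP; exists (fun i => p@_(wxyz_mnm i)).
apply/mpolyP => m; rewrite raddf_sum /=.
under eq_bigr => i _ do rewrite wxyz_mnmE mcoeffZ mcoeffX.
have [[i ->]|nm] := classic (exists i, m = wxyz_mnm i).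
  rewrite (bigD1 i) //= eqxx mulr1 big1 ?addr0 // => k ki.
  by rewrite (inj_eq wxyz_mnm_inj) (negPf ki) mulr0.
rewrite [RHS]big1; last first.
  move=> i _; case: eqP => [im|_]; rewrite ?mulr0 //.
  by case: nm; exists i.
apply/eqP; apply: contra_notT nm => pm; have m2 := is_homogP p2 m pm.
have [m0 mres] := mixed_coef p_mixed pm.
have [u [i [_ mE]]] := wxyz_monomial K m0 mres; exists i.
move/eqP: m2; rewrite mE mdegD -/(wxyz_mnm i) mdeg_wxyz_mnm.
by rewrite -[X in _ == X]add0n eqn_add2r mdeg_eq0 => /eqP->; rewrite add0m.
Qed.

(** Quadrics in three variables form a space of dimension [6]; a nonzero one in [Ann G] would leave
    a value of at most [5]. *)
Lemma no_quadric (K : fieldType) (G q : {mpoly K[3]}) :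
  hilb_at (Ann G) 2 6 -> is_homog 2 q -> Ann G q -> q = 0.
Proof.
move=> [b [c [[[s [sb [s2 /lin_indepE s_indep]]] _] [[_ maxc] bc]]]] q2 qG.
have := homog_indep_bound (@subspace_null _ _) s2 s_indep; rewrite sb => b6.
apply/eqP/negP => /negP q0; have /maxc : forall p, p \in [:: q] -> is_homog 2 p /\ Ann G p.
  by move=> p; rewrite inE => /eqP->.
have : lin_indep [:: q].
  apply/lin_indepE => e; rewrite /lincomb big_ord_recl big_ord0 addr0 /null /= => /eqP.
  by rewrite scaler_eq0 (negPf q0) orbF => /eqP e0 [].
move=> q_indep /(_ q_indep) /= c1.
have : (b - c <= 5)%N by rewrite leq_subLR (leq_trans b6) // (leq_add c1).
by rewrite -bc.
Qed.

Lemma in_C_split (K : fieldType) j (G : {mpoly K[3]}) H :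
  (2 < j)%N -> AG_dual j G -> (forall q, is_homog 2 q -> Ann G q -> q = 0) ->
  hilb_fun (Ann (split_dual j G 1)) H -> in_C H (split_dual j G 1).
Proof.
move=> j2 [Gj G0] J2 FH; have j0 : (0 < j)%N by apply: ltn_trans j2.
have a0 : 1 != 0 :> K := oner_neq0 K.
split; last split=> //.
  exists j; split; first exact: split_homog.
  apply/eqP => /(congr1 (mcoeff (wmnm j))); rewrite mcoeffD mcoeff_emb_wmnm.
  rewrite (gtn_eqF j0) add0r mcoeffZ WdpE mcoeffX eqxx mulr1 mcoeff0 => /eqP.
  by rewrite oner_eq0.
exists 1%:M; split; first exact: unitmx1.
split=> [p p2 pF|q q_span].
  rewrite coord_change1; apply: mixed_quadric => //.
  (* Because [2 < j], an annihilating quadric has no [w^2] term; modulo mixed terms it is its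
     restriction to [w = 0], which lies in [Ann G]. *)
  have [q2] := homog_reduce p2; rewrite (Ann_split_coeff a0 pF j2) !scale0r subr0 add0r.
  move=> p_mixed; suff res0 : res p = 0 by rewrite res0 raddf0 subr0 in p_mixed.
  apply: J2; first exact: res_homog.
  apply/(Ann_split_emb _ j0 Gj G0 a0).
  rewrite -[emb _](subKr p); apply: (subspaceB (subspace_Ann _)) => //.
  exact: mixed_contract.
exists q; rewrite coord_change1; split; last split=> //.
  case/in_span_wxyzP: q_span => c ->; apply: is_homog_sum => i _.
  by apply: (subspaceZ _ (@subspace_homog K 4 2)); rewrite wxyz_mnmE wxyz_homog.
exact/mixed_contract/mixed_span.
Qed.

Theorem theorem3p7 (K : closedFieldType) (j : nat) (hj : (4 <= j)%N) :
  (* (i) degree-j part of the inverse system of (wx,wy,wz) *)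
  (forall G0 : {mpoly K[4]}, is_homog j G0 ->
     ((forall h, ideal_gen_by
                   (fun p => p = vw * vx \/ p = vw * vy \/ p = vw * vz) h ->
                 contract h G0 = 0)
      <-> exists (G' : {mpoly K[3]}) (a : K),
            is_homog j G' /\ G0 = emb G' + a *: Wdp K j)) /\
  (* (ii) *)
  (forall F : {mpoly K[4]},
     AG_dual j F ->
     hilb_at (Ann F) 1 4 -> hilb_at (Ann F) 2 7 ->
     (forall p, is_homog 2 p -> (Ann F p <-> in_span_wxyz p)) ->
     let JI := fun q : {mpoly K[3]} => Ann F (emb q) in
     exists (G : {mpoly K[3]}) (alpha : K) (g : {mpoly K[3]}),
       [/\ is_homog j G, G != 0, alpha != 0 & F = emb G + alpha *: Wdp K j] /\
       (forall q, JI q <-> Ann G q) /\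
       [/\ is_homog j g, g != 0 & ~ JI g] /\
       (forall h, Ann F h <->
          ideal_gen_by (fun p => (exists q, JI q /\ p = emb q) \/
                                 p = vw * vx \/ p = vw * vy \/ p = vw * vz \/
                                 p = vw ^+ j - emb g) h) /\
       (forall s, minimal_gens JI s ->
          minimal_gens (Ann F)
            (map (@emb K) s ++ [:: vw * vx; vw * vy; vw * vz; vw ^+ j - emb g])) /\
       (forall i m, (1 <= i <= j.-1)%N ->
          (hilb_at (Ann F) i m <-> exists m', m = m'.+1 /\ hilb_at JI i m')) /\
       (forall i m, (i == 0)%N || (j <= i)%N ->
          (hilb_at (Ann F) i m <-> hilb_at JI i m)) /\
       (forall G0, is_homog j G0 ->
          ((forall h, Ann F h -> contract h G0 = 0) <-> exists c : K, G0 = c *: F)) /\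
       (forall i G0, (j < i)%N -> is_homog i G0 ->
          (forall h, Ann F h -> contract h G0 = 0) -> G0 = 0) /\
       (forall i G0, (1 <= i <= j.-1)%N -> is_homog i G0 ->
          ((forall h, Ann F h -> contract h G0 = 0) <->
             exists h, G0 = contract h F) /\
          ((exists h, G0 = contract h F) <->
             exists (h' : {mpoly K[3]}) (a : K),
               G0 = emb (contract h' G) + a *: Wdp K i))) /\
  (* (iii) *)
  (forall H : nat -> nat,
     @gor_seq_sd K 4 H j -> H 0%N = 1%N -> H 1%N = 4%N -> H 2%N = 7%N ->
     ((exists F : {mpoly K[4]}, in_C H F) <->
      (let H' := fun i => (H i - (if (1 <= i <= j.-1)%N then 1 else 0))%N in
       @gor_seq K 3 H' /\ H' 1%N = 3%N))).
Proof.
have j0 : (0 < j)%N by apply: leq_trans hj.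
have j2 : (2 < j)%N by apply: leq_trans hj.
have lt_j i : (i <= j.-1)%N = (i < j)%N by rewrite -ltnS prednK.
have end_cases i : ~~ (1 <= i <= j.-1)%N = (i == 0)%N || (j <= i)%N.
  by rewrite lt_j negb_and -leqNgt leqn0 -leqNgt.
split; first by move=> G0 G0j; apply: perp_wxyz.
split=> [F Fdual _ _ I2 JI|H [F0 [F0_dual F0H]] H0 H1 H2].
  have [G [a [Gj G0 a0 FE J2]]] := exists_split_dual j2 Fdual I2.
  have [g [gj gG]] := exists_socle_gen a Gj G0.
  have JG q : JI q <-> Ann G q by rewrite /JI FE; apply: Ann_split_emb.
  have gJ : ~ JI g.
    by move/JG; rewrite /Ann gG => /eqP; rewrite mpolyC_eq0 (negPf a0).
  have hJG i m : hilb_at JI i m <-> hilb_at (Ann G) i m.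
    by split; apply: hilb_at_ext => q; rewrite JG.
  have Fj := Fdual.1; exists G, a, g; split; first by [].
  split; first exact: JG.
  split.
    by split=> //; apply: contra_notN gJ => /eqP->; rewrite /JI raddf0 /Ann contract0l.
  split; first by move=> h; rewrite /JI FE; apply: Ann_split_gens.
  split=> [s [sh [sJ smin]]|].
    rewrite FE; apply: minimal_gens_split => //.
    by split=> //; split=> // h; rewrite -JG.
  split=> [i m|].
    rewrite lt_j FE => ij; rewrite (hilb_split_mid m Gj G0 a0 ij).
    by split=> -[m' [-> ?]]; exists m'; split=> //; apply/hJG.
  split=> [i m ij|]; first by rewrite hJG FE; apply: hilb_split_end.
  split=> [G0' G0j|]; first exact: perp_top Fj G0j.
  split=> [i G0' ji G0i|i G0']; first exact: perp_above Fj ji G0i.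
  rewrite lt_j => /andP[i0 ij] G0i; split; first exact: perp_Ann.
  by rewrite FE; apply: inverse_system_split.
split=> [[F [[d Fd] [FH [M [Munit [IM MI]]]]]]|[[d [G [Gd GH]]] _]].
  have dj : d = j by apply: socle_degree_uniq F0_dual Fd F0H FH _.
  rewrite {d}dj in Fd.
  have MN := mulmxV Munit; have NM := mulVmx Munit.
  (* The inverse matrix enters because [Ann F'] has to be the image of [Ann F] under
     [coord_change M]; its quadrics are then exactly the span of [wx, wy, wz]. *)
  have [F' [F'dual F'_Ann]] := coord_change_dual MN NM Fd.
  have I2 p : is_homog 2 p -> (Ann F' p <-> in_span_wxyz p).
    move=> p2; rewrite F'_Ann; split=> [pF|/MI[q [_ [qF <-]]]].
      rewrite -[p](coord_changeK NM); apply: IM pF.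
      exact: coord_change_homog.
    by rewrite (coord_changeK MN).
  have [G [a [Gj G0 a0 F'E J2]]] := exists_split_dual j2 F'dual I2.
  split; last by rewrite lt_j (ltn_trans _ j2) // H1.
  exists j, G; split=> // i; have := hilb_coord_change MN NM F'_Ann (FH i).
  rewrite F'E; case: ifP => [|/negbT]; last first.
    by rewrite end_cases => ij; rewrite subn0 => /(hilb_split_end _ j0 Gj G0 a0 ij).
  rewrite lt_j => ij /(hilb_split_mid _ Gj G0 a0 ij)[m [-> mG]].
  by rewrite subn1.
(* [H'] differs from [H] only in degrees [1] to [j - 1], so both end in the same degree. *)
have dj : d = j.
  apply: socle_degree_uniq F0_dual Gd F0H GH _ => i ji.
  by rewrite ifN ?subn0 // end_cases ji orbT.
rewrite {d}dj in Gd; have [Gj G0] := Gd; have a0 : 1 != 0 :> K := oner_neq0 K.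
exists (split_dual j G 1); apply: in_C_split => //.
  move=> q; apply: no_quadric; have := GH 2%N.
  by rewrite lt_j j2 H2.
move=> i; have := GH i; case: ifP => [|/negbT].
  rewrite lt_j => ij Gi; apply/(hilb_split_mid _ Gj G0 a0 ij).
  (* The subtraction is truncated: [H i] is recovered from [H i - 1] because it is positive up to
     the socle degree of [F0]. *)
  exists (H i - 1)%N; split=> //; case/andP: ij => _ /ltnW ij.
  by rewrite subn1 prednK // (hilb_pos F0_dual ij (F0H i)).
by rewrite end_cases subn0 => ij Gi; apply/(hilb_split_end _ j0 Gj G0 a0 ij).
Qed.
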